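(* Let $n\ge 3$, $p,q>1$ and $a,b\in\mathbb{R}$. The system of inequalities $$ \begin{cases} -\Delta u\ge \lambda_1|x|^a v^{p-1}\\ -\Delta v\ge \lambda_2|x|^b u^{q-1} \end{cases} $$ has a positive distributional solution $u,v$ on $\mathbb{R}^n\setminus\{0\}$ (for some $\lambda_1,\lambda_2>0$) if and only if, for some $\lambda_1,\lambda_2>0$, the system of equations $$ \begin{cases} -\Delta u= \lambda_1|x|^a v^{p-1}\\ -\Delta v= \lambda_2|x|^b u^{q-1} \end{cases} $$ has a positive power-type solution on $\mathbb{R}^n\setminus\{0\}$, that is, a solution of the form $u(x)=c_1|x|^\alpha$, $v(x)=c_2|x|^\beta$ with $c_1,c_2>0$ and $\alpha,\beta\in\mathbb{R}$.
   Context: A positive distributional solution of the system of inequalities on $\mathbb{R}^n\setminus\{0\}$ is a pair $u,v$ of (almost everywhere) positive functions with $u,v\in L^1_{\rm loc}(\mathbb{R}^n\setminus\{0\})$ and $u^{q-1},v^{p-1}\in L^1_{\rm loc}(\mathbb{R}^n\setminus\{0\})$, for which there exist $\lambda_1,\lambda_2>0$ such that both inequalities hold in the sense of distributions on $\mathbb{R}^n\setminus\{0\}$. (The constants $\lambda_1,\lambda_2$ are not prescribed; they are part of the solution.) *)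

(* Defs.v *)
From HB Require Import structures.
From mathcomp Require Import all_boot all_order all_algebra.
From mathcomp Require Import all_classical all_reals all_analysis.

Set Implicit Arguments.
Unset Strict Implicit.
Unset Printing Implicit Defensive.

Import Order.TTheory GRing.Theory Num.Def Num.Theory.
Import numFieldNormedType.Exports.

Local Open Scope classical_set_scope.
Local Open Scope ring_scope.

(* 'rV[R]_n carries the product sigma-algebra, generated by the coordinate
   maps, i.e. the Borel sigma-algebra of R^n. *)
Definition measure_rV_display : measure_display.
Proof. exact: default_measure_display. Qed.

Section measurable_rV.
Context {R : realType} {n : nat}.

Definition coord_rV (i : 'I_n) (x : 'rV[R]_n) : measurableTypeR R := x ord0 i.

Let rV_set0 : g_sigma_preimage coord_rV set0.
Proof. exact: sigma_algebra0. Qed.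

Let rV_setC A : g_sigma_preimage coord_rV A -> g_sigma_preimage coord_rV (~` A).
Proof. exact: sigma_algebraC. Qed.

Let rV_bigcup (F : _^nat) : (forall i, g_sigma_preimage coord_rV (F i)) ->
  g_sigma_preimage coord_rV (\bigcup_i (F i)).
Proof. exact: sigma_algebra_bigcup. Qed.

HB.instance Definition _ := @isMeasurable.Build measure_rV_display
  'rV[R]_n (g_sigma_preimage coord_rV) rV_set0 rV_setC rV_bigcup.

Lemma measurable_coord_rV (i : 'I_n) :
  measurable_fun [set: 'rV[R]_n] (coord_rV i).
Proof.
move=> _ Y mY; rewrite setTI; apply: sub_sigma_algebra => /=.
rewrite -bigcup_seq/=; exists i => /=; first by rewrite mem_index_enum.
by exists Y => //; rewrite setTI.
Qed.

Lemma measurable_fun_rV d (T : measurableType d) (f : T -> 'rV[R]_n) :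
  (forall i, measurable_fun [set: T] (coord_rV i \o f)) ->
  measurable_fun [set: T] f.
Proof.
move=> mf _ B mB; rewrite setTI.
suff : g_sigma_preimage coord_rV `<=` [set B | measurable (f @^-1` B)].
  exact.
apply: smallest_sub; first split => /=.
- by rewrite preimage_set0.
- by move=> A mA; rewrite setTD preimage_setC; exact: measurableC.
- by move=> F mF; rewrite preimage_bigcup; exact: bigcup_measurable.
rewrite -bigcup_seq => A [i _ [Y mY <-]] /=; rewrite setTI.
have := mf i measurableT Y mY.
by rewrite setTI comp_preimage.
Qed.

End measurable_rV.

Section cons_rV.
Context {R : realType} {n : nat}.

Definition cons_rV (z : measurableTypeR R * 'rV[R]_n) : 'rV[R]_n.+1 :=
  \row_i oapp (fun j => z.2 ord0 j) z.1 (unlift ord0 i).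

Definition uncons_rV (x : 'rV[R]_n.+1) : measurableTypeR R * 'rV[R]_n :=
  (x ord0 ord0, \row_j x ord0 (lift ord0 j)).

Lemma cons_rVK : cancel cons_rV uncons_rV.
Proof.
case=> t y; rewrite /uncons_rV /cons_rV; congr pair.
  by rewrite mxE unlift_none.
by apply/rowP => j; rewrite !mxE liftK.
Qed.

Lemma measurable_cons_rV : measurable_fun setT cons_rV.
Proof.
apply: measurable_fun_rV => i.
case: (unliftP ord0 i) => [j ->|->].
- rewrite [X in measurable_fun _ X](_ : _ = coord_rV j \o snd).
    by apply: measurableT_comp; [exact: measurable_coord_rV|].
  by apply/funext => z; rewrite /coord_rV /cons_rV /= mxE liftK.
- rewrite [X in measurable_fun _ X](_ : _ = fst) //.
  by apply/funext => z; rewrite /coord_rV /cons_rV /= mxE unlift_none.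
Qed.

Lemma measurable_uncons_rV : measurable_fun setT uncons_rV.
Proof.
apply: measurable_fun_pair; first exact: measurable_coord_rV.
apply: measurable_fun_rV => j.
rewrite [X in measurable_fun _ X](_ : _ = coord_rV (lift ord0 j)).
  exact: measurable_coord_rV.
by apply/funext => x; rewrite /coord_rV /= mxE.
Qed.

Variable m : {sigma_finite_measure set 'rV[R]_n -> \bar R}.

Definition cons_measure : set 'rV[R]_n.+1 -> \bar R :=
  pushforward (@lebesgue_measure R \x m)%E cons_rV.

Let cons_measure0 : cons_measure set0 = 0%E.
Proof. by rewrite /cons_measure /pushforward preimage_set0 measure0. Qed.

Let cons_measure_ge0 A : (0 <= cons_measure A)%E.
Proof. by rewrite /cons_measure /pushforward; exact: measure_ge0. Qed.

Let cons_measure_sigma_additive : semi_sigma_additive cons_measure.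
Proof.
move=> F mF tF mUF; rewrite /cons_measure /pushforward preimage_bigcup.
apply: measure_semi_sigma_additive.
- by move=> k; rewrite -[X in measurable X]setTI; exact: measurable_cons_rV.
- apply/trivIsetP => /= i j _ _ ij; rewrite -preimage_setI.
  by move/trivIsetP : tF => /(_ _ _ _ _ ij) ->//; rewrite preimage_set0.
- by rewrite -preimage_bigcup -[X in measurable X]setTI; exact: measurable_cons_rV.
Qed.

HB.instance Definition _ := isMeasure.Build _ _ _ cons_measure
  cons_measure0 cons_measure_ge0 cons_measure_sigma_additive.

Let cons_measure_sigma_finite : sigma_finite setT cons_measure.
Proof.
have /sigma_finiteP[F [TF ndF Foo]] := sigma_finiteT (@lebesgue_measure R).
have /sigma_finiteP[G [TG ndG Goo]] := sigma_finiteT m.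
exists (fun k => uncons_rV @^-1` (F k `*` G k)).
  apply/esym; rewrite -subTset => x _.
  have [i _ Fi] : (\bigcup_i F i) (uncons_rV x).1 by rewrite -TF.
  have [j _ Gj] : (\bigcup_j G j) (uncons_rV x).2 by rewrite -TG.
  exists (maxn i j) => //; split.
  - by move: Fi; exact/subsetPset/ndF/leq_maxl.
  - by move: Gj; exact/subsetPset/ndG/leq_maxr.
move=> k; have [mFk Fk] := Foo k; have [mGk Gk] := Goo k; split.
  rewrite -[X in measurable X]setTI; apply: measurable_uncons_rV => //.
  exact: measurableX.
rewrite /cons_measure /pushforward -comp_preimage.
rewrite (_ : _ \o _ = id); last by apply/funext => z /=; rewrite cons_rVK.
by rewrite preimage_id product_measure1E// lte_mul_pinfty// ge0_fin_numE.
Qed.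

HB.instance Definition _ := Measure_isSigmaFinite.Build _ _ _ cons_measure
  cons_measure_sigma_finite.

End cons_rV.

(* n-dimensional Lebesgue measure, as an iterated product. *)
Fixpoint lebesgue_rV (R : realType) (n : nat) :
    {sigma_finite_measure set 'rV[R]_n -> \bar R} :=
  match n with
  | 0 => \d_(0 : 'rV[R]_0)
  | n'.+1 => cons_measure (lebesgue_rV R n')
  end.

Lemma lebesgue_rV_box (R : realType) (n : nat) (A : 'I_n -> set R) :
  (forall i, measurable (A i : set (measurableTypeR R))) ->
  lebesgue_rV R n [set x | forall i, A i (x ord0 i)] =
  (\prod_(i < n) lebesgue_measure (A i))%E.
Proof.
elim: n A => [|n IH] A mA.
  rewrite big_ord0 /= diracE (_ : _ \in _) //; apply/mem_set => -[] //.
rewrite big_ord_recl -IH //= /cons_measure /pushforward.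
rewrite -product_measure1E //; last first.
  rewrite [X in measurable X](_ : _ = \bigcap_(i in [set: 'I_n])
    (coord_rV i @^-1` A (lift ord0 i))).
    apply: fin_bigcap_measurable => // i _.
    by rewrite -[X in measurable X]setTI; exact: measurable_coord_rV.
  by apply/seteqP; split => x /= h i; [move=> _; exact: h|exact: (h i Logic.I)].
congr product_measure1; apply/seteqP; split => -[t y] /=.
- move=> h; split => [|i].
    by have := h ord0; rewrite /cons_rV mxE unlift_none.
  by have := h (lift ord0 i); rewrite /cons_rV mxE liftK.
- move=> [h0 h] i; rewrite /cons_rV mxE.
  by case: unliftP => [j ->|->] /=.
Qed.

Section distributions.
Context {R : realType} {n : nat}.
Implicit Types (u f phi : 'rV[R]_n -> R) (D : set 'rV[R]_n) (x : 'rV[R]_n).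

(* Euclidean norm: the library norm `|x| on 'rV[R]_n is the sup norm. *)
Definition enorm x : R := Num.sqrt (\sum_(i < n) x ord0 i ^+ 2).

Definition punctured : set 'rV[R]_n := [set x | x != 0].

Definition partial (i : 'I_n) f : 'rV[R]_n -> R :=
  fun x => 'D_(delta_mx ord0 i) f x.

Definition partials (s : seq 'I_n) f : 'rV[R]_n -> R := foldr partial f s.

Definition laplacian f : 'rV[R]_n -> R :=
  fun x => \sum_(i < n) partial i (partial i f) x.

Definition smooth f : Prop := forall s : seq 'I_n,
  continuous (partials s f) /\
  forall (i : 'I_n) x, derivable (partials s f) x (delta_mx ord0 i).

(* phi is in C_c^oo(D), extended by zero. *)
Definition test_function D phi : Prop :=
  [/\ smooth phi, compact (closure [set x | phi x != 0]) &
      closure [set x | phi x != 0] `<=` D].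

Definition loc_integrable D f : Prop :=
  measurable_fun D f /\
  forall K, K `<=` D -> compact K ->
    (lebesgue_rV R n).-integrable K (EFin \o f).

(* - Delta u >= f and - Delta u = f in the sense of distributions on D. *)
Definition neg_laplacian_ge D u f : Prop :=
  forall phi, test_function D phi -> (forall x, 0 <= phi x) ->
  (\int[lebesgue_rV R n]_(x in D) (f x * phi x)%:E <=
   \int[lebesgue_rV R n]_(x in D) (u x * - laplacian phi x)%:E)%E.

Definition neg_laplacian_eq D u f : Prop :=
  forall phi, test_function D phi ->
  (\int[lebesgue_rV R n]_(x in D) (u x * - laplacian phi x)%:E =
   \int[lebesgue_rV R n]_(x in D) (f x * phi x)%:E)%E.

Definition positive_pair (p q : R) (u v : 'rV[R]_n -> R) : Prop :=
  [/\ {ae lebesgue_rV R n, forall x, punctured x -> 0 < u x /\ 0 < v x},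
      loc_integrable punctured u,
      loc_integrable punctured v,
      loc_integrable punctured (fun x => u x `^ (q - 1)) &
      loc_integrable punctured (fun x => v x `^ (p - 1))].

Definition system_supersolution (p q a b l1 l2 : R) (u v : 'rV[R]_n -> R) :=
  [/\ positive_pair p q u v,
      neg_laplacian_ge punctured u
        (fun x => l1 * enorm x `^ a * v x `^ (p - 1)) &
      neg_laplacian_ge punctured v
        (fun x => l2 * enorm x `^ b * u x `^ (q - 1))].

Definition system_solution (p q a b l1 l2 : R) (u v : 'rV[R]_n -> R) :=
  [/\ positive_pair p q u v,
      neg_laplacian_eq punctured u
        (fun x => l1 * enorm x `^ a * v x `^ (p - 1)) &
      neg_laplacian_eq punctured v
        (fun x => l2 * enorm x `^ b * u x `^ (q - 1))].

Definition power_fun (c alpha : R) : 'rV[R]_n -> R :=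
  fun x => c * enorm x `^ alpha.

End distributions.

(* Main.v *)
(* In log-polar coordinates a positive superharmonic function on R^n \ {0} is
   governed by its averages U_k over cubes Q_k of size e^k at distance e^k from 0.
   Testing -Delta u >= f against bump (barrier x), where the barrier is a smoothed
   pole at a point of Q_j minus a small multiple of |x|^((2-n)/2) (which cuts off
   the origin and is strictly superharmonic), bounds the averages of u over all
   small balls centred in Q_j from below by c U_k min (1, e^((n-2)(k-j))) and by the
   corresponding Green potential of f.  Differentiating along nested grids turns
   this into almost everywhere lower bounds on Q_j, so that v^(p-1) can be bounded
   below by V_k^(p-1) for every p > 1, without Jensen's inequality.
   The resulting inequalities between the sequences U and V force the
   linear system al = a + 2 + be (p-1), be = b + 2 + al (q-1) to have a solution in
   ]2-n, 0[^2, which is exactly what makes |x|^al, |x|^be a power-type solution. *)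

Require Import Defs.
From mathcomp Require Import all_boot all_order all_algebra.
From mathcomp Require Import all_classical all_reals all_analysis.
From mathcomp Require Import measurable_realfun.
From mathcomp Require Import ring lra zify.

Set Implicit Arguments.
Unset Strict Implicit.
Unset Printing Implicit Defensive.

Import Order.TTheory GRing.Theory Num.Def Num.Theory.
Import numFieldNormedType.Exports.

Local Open Scope classical_set_scope.
Local Open Scope ring_scope.

(** * Grids and measurability *)

Section grids.
Context {R : realType} {n : nat}.
Implicit Types (h : R) (k : nat) (x y : 'rV[R]_n) (A B : set 'rV[R]_n).

(** The solutions are only measurable, and a test function has to vanish near 0 and near infinity,
    so every estimate must come from one explicit nonnegative test function. Two properties of
    [bump] make truncating the barrier harmless: it is convex, so the gradient term in the Laplacian
    of the composition has a sign, and its slope is at most 1. What remains is a positive mass in a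
    small ball around the pole and, from the power |x|^((2-n)/2), a negative density wherever the
    barrier is positive. Moving that density to the other side compares the average over a distant
    cube with that over a small ball: the cut-off term is also the source of the Harnack bound. One
    cube per scale is enough, so no sphere has to be covered. For the sequences, an exponent outside
    ]2-n, 0[ makes arbitrarily many scales contribute a fixed amount to the Green potential at a
    scale where u is bounded. When the linear system is nondegenerate only the upper end 0 is
    treated directly, and a Kelvin transform exchanges it with 2-n; the degenerate system, whose
    solutions form a line, needs its own argument. *)

Definition grid h k x : 'rV[int]_n := \row_i Num.floor (2 ^+ k * x ord0 i / h).

Definition cell h k (t : 'rV[int]_n) : set 'rV[R]_n := grid h k @^-1` [set t].

Lemma cellE h k t : 0 < h -> cell h k t =
  [set x | forall i, [set` `[h / 2 ^+ k * (t ord0 i)%:~R,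
                             h / 2 ^+ k * (t ord0 i + 1)%:~R[] (x ord0 i)].
Proof.
move=> h0; have k0 : 0 < 2 ^+ k :> R by rewrite exprn_gt0.
have e s z : (h / 2 ^+ k * s <= z) = (s <= 2 ^+ k * z / h).
  by rewrite ler_pdivlMr// mulrAC ler_pdivrMr// [z * _]mulrC [h * s]mulrC.
apply/seteqP; split => x /=.
  move=> /rowP xt i; have := xt i; rewrite mxE => <-.
  by rewrite in_itv /= e ltNge e -ltNge floor_itv.
move=> xt; apply/rowP => i; rewrite mxE; apply: floor_def.
by have := xt i; rewrite in_itv /= e ltNge e -ltNge.
Qed.

Lemma measurable_box (Y : 'I_n -> set R) :
  (forall i, measurable (Y i : set (measurableTypeR R))) ->
  measurable [set x : 'rV[R]_n | forall i, Y i (x ord0 i)].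
Proof.
move=> mY; rewrite [X in measurable X](_ : _ = \bigcap_(i in [set: 'I_n])
    (coord_rV i @^-1` Y i)).
  apply: fin_bigcap_measurable => // i _.
  by rewrite -[X in measurable X]setTI; exact: measurable_coord_rV.
by apply/seteqP; split => x /= H i; [move=> _; exact: H|exact: (H i Logic.I)].
Qed.

Lemma measurable_cell h k t : 0 < h -> measurable (cell h k t).
Proof.
move=> h0; rewrite cellE//.
by apply: (@measurable_box (fun i => [set` `[h / 2 ^+ k * (t ord0 i)%:~R,
  h / 2 ^+ k * (t ord0 i + 1)%:~R[])) => i; exact: measurable_itv.
Qed.

Lemma lebesgue_cell h k t : 0 < h ->
  lebesgue_rV R n (cell h k t) = ((h / 2 ^+ k) ^+ n)%:E.
Proof.
move=> h0; have hk : 0 < h / 2 ^+ k by rewrite divr_gt0// exprn_gt0.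
rewrite cellE// (@lebesgue_rV_box R n (fun i => [set` `[h / 2 ^+ k * (t ord0 i)%:~R,
  h / 2 ^+ k * (t ord0 i + 1)%:~R[]))//.
under eq_bigr do rewrite lebesgue_measure_itv /= lte_fin ltr_pM2l// ltr_int ltrDl ltr01.
under eq_bigr do rewrite -EFinB -mulrBr intrD addrAC subrr add0r mulr1.
by rewrite prodEFin prodr_const card_ord.
Qed.

Lemma grid_preimageE h k T :
  grid h k @^-1` T = \bigcup_t (if asbool (T t) then cell h k t else set0).
Proof.
apply/seteqP; split => x /=.
  by move=> Tx; exists (grid h k x) => //; case: asboolP.
by move=> [t _]; case: asboolP => // Tt; rewrite /cell /= => ->.
Qed.

Lemma measurable_grid h k T : 0 < h -> measurable (grid h k @^-1` T).
Proof.
move=> h0; rewrite grid_preimageE; apply: (@countable_bigcupT_measurable _ _ _ (fun t => if asbool (T t) then cell h k t else set0)).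
  exact: countableP.
by move=> t; case: asboolP => // _; exact: measurable_cell.
Qed.

(** The ratio of the two meshes is an integer [m], and then the floor of [m * c] determines that of
    [c]. This nesting is the reason for dividing the mesh by powers of two. *)
Lemma grid_refine h k k' T : (k <= k')%N ->
  exists T', grid h k @^-1` T = grid h k' @^-1` T'.
Proof.
move=> kk'.
have ref x y : grid h k' x = grid h k' y -> grid h k x = grid h k y.
  move=> /rowP xy; apply/rowP => i; have := xy i; rewrite !mxE.
  have e z : 2 ^+ k' * z / h = 2 ^+ (k' - k) * (2 ^+ k * z / h).
    by rewrite -[in LHS](subnK kk') exprD !mulrA.
  rewrite !e; move: (_ / h) (y _ _) => a b; move: (2 ^+ k * b / h) => {}b.
  set m : R := 2 ^+ (k' - k); have m0 : 0 < m by rewrite exprn_gt0.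
  have mE : m = (2 ^+ (k' - k) : int)%:~R by rewrite /m rmorphXn.
  move=> ab; apply/eqP; rewrite eq_le !floor_ge_int.
  have aux c d : Num.floor (m * c) = Num.floor (m * d) ->
      (Num.floor c)%:~R <= d.
    move=> cd; rewrite -(ler_pM2l m0) mE -intrM -floor_ge_int -mE -cd.
    by rewrite floor_ge_int intrM -mE ler_pM2l// floor_le.
  by rewrite !aux.
exists [set t' | exists2 x, grid h k' x = t' & T (grid h k x)].
apply/seteqP; split => x /=; first by exists x.
by move=> [y /ref <-].
Qed.

Lemma near_cell h x (e : R) : 0 < h -> 0 < e ->
  exists k, cell h k (grid h k x) `<=` ball x e.
Proof.
move=> h0 e0; have [k hk] : exists k, h / 2 ^+ k < e.
  exists (Num.bound (h / e)); rewrite ltr_pdivrMr ?exprn_gt0// -ltr_pdivrMl//.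
  rewrite mulrC; apply: lt_le_trans (archi_boundP _) _; first by rewrite divr_ge0// ltW.
  by rewrite -natrX ler_nat ltnW// ltn_expl.
exists k; rewrite cellE// => y yx; split => // i j; rewrite ord1.
have : cell h k (grid h k x) x by [].
rewrite cellE// => /(_ j) /=; move: (yx j); rewrite /= !in_itv /= intrD mulrDr mulr1.
rewrite /ball /= ltr_norml; lra.
Qed.

(** The sigma-algebra is generated by the coordinates, not by the topology; an open set is the
    countable union of the grid cells that it contains. *)
Lemma open_measurable_rV A : open A -> measurable A.
Proof.
move=> oA; rewrite (_ : A = \bigcup_k (grid 1 k @^-1` [set t | cell 1 k t `<=` A])).
  by apply: bigcupT_measurable => k; exact: measurable_grid.
apply/seteqP; split => x /=.
  move=> Ax; have /nbhs_ballP[e e0 eA] : nbhs x A by exact: open_nbhs_nbhs.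
  have [k ke] := @near_cell 1 x e ltr01 e0.
  by exists k => //=; exact: subset_trans ke eA.
by move=> [k _ /=]; apply.
Qed.

Lemma closed_measurable_rV A : closed A -> measurable A.
Proof.
move=> cA; rewrite -[A]setCK; apply: measurableC; apply: open_measurable_rV.
exact: closed_openC.
Qed.

Lemma continuous_measurable_rV A (f : 'rV[R]_n -> R) : open A ->
  (forall x, A x -> {for x, continuous f}) -> measurable_fun A f.
Proof.
move=> oA cf; apply: (measurability _ (RGenOInfty.measurableE R)).
move=> _ [_ [a ->] <-]; apply: open_measurable_rV.
rewrite openE => x [Ax fx]; have nA : nbhs x A by apply: open_nbhs_nbhs; split.
have nf : nbhs (f x) `]a, +oo[%classic.
  by apply: open_nbhs_nbhs; split => //; exact: itv_open.
exact: filterI nA (cf x Ax _ nf).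
Qed.

Section approximation.
Variables (h : R) (h0 : 0 < h) (mu : {measure set 'rV[R]_n -> \bar R}).
Hypothesis mu_fin : (mu setT < +oo)%E.

Let sdiff A B := (A `\` B) `|` (B `\` A).

Let approx A := forall e : R, 0 < e ->
  exists k T, (mu (sdiff A (grid h k @^-1` T)) <= e%:E)%E.

Let msdiff A B : measurable A -> measurable B -> measurable (sdiff A B).
Proof. by move=> mA mB; apply: measurableU; exact: measurableD. Qed.

Let approxC A : approx A -> approx (~` A).
Proof.
move=> aA e e0; have [k [T hT]] := aA e e0; exists k, (~` T).
rewrite preimage_setC [sdiff _ _](_ : _ = sdiff A (grid h k @^-1` T))//.
apply/seteqP; rewrite /sdiff /setD /setC; split => x /=;
  have := pselect (A x); have := pselect (T (grid h k x)); tauto.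
Qed.

Let approxU A B : measurable A -> measurable B -> approx A -> approx B ->
  approx (A `|` B).
Proof.
move=> mA mB aA aB e e0; have e20 : 0 < e / 2 by rewrite divr_gt0.
have [k [T hT]] := aA _ e20; have [k' [T' hT']] := aB _ e20.
have [S eS] := @grid_refine h k (maxn k k') T (leq_maxl _ _).
have [S' eS'] := @grid_refine h k' (maxn k k') T' (leq_maxr _ _).
exists (maxn k k'), (S `|` S'); rewrite preimage_setU -eS -eS'.
set G := grid _ _ @^-1` _; set G' := grid _ _ @^-1` _.
have mG : measurable G by exact: measurable_grid.
have mG' : measurable G' by exact: measurable_grid.
apply: (@le_trans _ _ (mu (sdiff A G `|` sdiff B G'))%E).
  apply: le_measure; rewrite ?inE; [|apply: measurableU|]; try exact: msdiff.
    by apply: msdiff; exact: measurableU.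
  by rewrite /sdiff /setD => x /=; tauto.
apply: le_trans (measureU2 _ _ _) _; try exact: msdiff.
by rewrite [e in leRHS](_ : e = e / 2 + e / 2) ?EFinD ?leeD//; lra.
Qed.

Let approx_bigcup (F : (set 'rV[R]_n)^nat) : (forall i, measurable (F i)) ->
  (forall i, approx (F i)) -> approx (\bigcup_i F i).
Proof.
move=> mF aF e e0; have e20 : 0 < e / 2 by rewrite divr_gt0.
set U := \bigcup_i F i; pose V N := \big[setU/set0]_(i < N) F i.
have mV N : measurable (V N) by exact: bigsetU_measurable.
have mU : measurable U by exact: bigcupT_measurable.
have aV N : approx (V N).
  elim: N => [|N IH]; rewrite /V ?big_ord0 ?big_ord_recr /=; last first.
    by apply: approxU => //; exact: (mV N).
  move=> d d0; exists 0%N, set0.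
  by rewrite preimage_set0 /sdiff setD0 setU0 measure0 lee_fin ltW.
have DV : mu \o (fun N => U `\` V N) @ \oo --> 0%E.
  rewrite -(measure0 mu) (_ : set0 = \bigcap_N (U `\` V N)).
    apply: nonincreasing_cvg_mu => //.
    - by apply: le_lt_trans mu_fin; apply: le_measure; rewrite ?inE//; exact: measurableD.
    - by move=> N; exact: measurableD.
    - by apply: bigcapT_measurable => N; exact: measurableD.
    move=> N M NM; apply/subsetPset; apply: setDS; rewrite /V -!bigcup_mkord.
    by move=> x [i /= iN Fi]; exists i => //=; exact: leq_trans iN NM.
  apply/esym; rewrite -subset0 => x Ux; have [[i _ Fi] _] := Ux 0%N Logic.I.
  have [_] := Ux i.+1 Logic.I; apply.
  by rewrite /V -bigcup_mkord; exists i => /=.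
have /fine_cvgP[_ /cvgrPdist_le /(_ _ e20)] := DV.
move=> [M _ /(_ M (leqnn _))] /=; rewrite sub0r normrN.
have DfM : mu (U `\` V M) \is a fin_num.
  have mD := measurableD mU (mV M).
  rewrite ge0_fin_numE//; apply: le_lt_trans mu_fin.
  by apply: le_measure; rewrite ?inE.
rewrite ger0_norm ?fine_ge0// => hM.
have [k [T hT]] := aV M _ e20; exists k, T; set G := grid _ _ @^-1` _.
have mG : measurable G by exact: measurable_grid.
apply: (@le_trans _ _ (mu ((U `\` V M) `|` sdiff (V M) G))%E).
  have mD := measurableD mU (mV M); have mS := msdiff (mV M) mG.
  apply: le_measure; rewrite ?inE; [exact: msdiff|exact: measurableU|].
  have VU : V M `<=` U by rewrite /V -bigcup_mkord => x [i _ Fi]; exists i.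
  rewrite /sdiff /setD => x /=; have := VU x; have := pselect (V M x); tauto.
have mD := measurableD mU (mV M); have mS := msdiff (mV M) mG.
apply: le_trans (measureU2 mu mD mS) _.
rewrite [e in leRHS](_ : e = e / 2 + e / 2); last lra.
rewrite EFinD leeD//.
by rewrite -[leLHS]fineK// lee_fin.
Qed.

(** The approximable sets form a sigma-algebra: unions of cells of two levels become unions of cells
    of the finer level, and finiteness of [mu] makes the tail of a countable union small. Only the
    generators remain, that is, half-spaces in one coordinate. *)
Lemma grid_approximation A : measurable A -> forall e : R, 0 < e ->
  exists k T, (mu ((A `\` (grid h k @^-1` T)) `|` ((grid h k @^-1` T) `\` A))
    <= e%:E)%E.
Proof.
move=> mA; change (approx A).
have ap0 : approx set0.
  move=> d d0; exists 0%N, set0.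
  by rewrite preimage_set0 /sdiff setD0 setU0 measure0 lee_fin ltW.
suff: g_sigma_preimage (@coord_rV R n) `<=` [set B | measurable B /\ approx B].
  by move=> /(_ A mA)[].
apply: smallest_sub; first split => /=.
- by split => //.
- by move=> B [mB aB]; rewrite setTD; split; [exact: measurableC|exact: approxC].
- move=> F mF; split; first by apply: bigcupT_measurable => i; have [] := mF i.
  by apply: approx_bigcup => i; have [] := mF i.
rewrite -bigcup_seq => B [i _ [Y mY <-]] /=; rewrite setTI.
split; first by rewrite -[X in measurable X]setTI; exact: measurable_coord_rV.
have : <<s @RGenOInfty.G R >> `<=`
    [set Y | measurable (Y : set (measurableTypeR R)) /\ approx (coord_rV i @^-1` Y)].
  apply: smallest_sub; first split => /=.
  - by split => //; rewrite preimage_set0.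
  - move=> Z [mZ aZ]; rewrite setTD; split; first exact: measurableC.
    by rewrite preimage_setC; exact: approxC.
  - move=> F mF; split; first by apply: bigcupT_measurable => j; have [] := mF j.
    rewrite preimage_bigcup; apply: approx_bigcup => j; last by have [] := mF j.
    rewrite -[X in measurable X]setTI; apply: measurable_coord_rV => //.
    by have [] := mF j.
  - move=> _ [c ->]; split; first exact: measurable_itv.
    (* The half-space is exhausted from inside by the cells whose index exceeds that of [c]; a point
       of it is reached as soon as the mesh is smaller than its distance to the boundary. *)
    rewrite [X in approx X](_ : _ = \bigcup_k (grid h k @^-1`
        [set t | (Num.floor (2 ^+ k * c / h) < t ord0 i)%R])).
      apply: approx_bigcup => k; first exact: measurable_grid.
      move=> d d0; exists k, [set t | (Num.floor (2 ^+ k * c / h) < t ord0 i)%R].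
      by rewrite /sdiff !setDv setU0 measure0 lee_fin ltW.
    apply/seteqP; split => x /=.
      rewrite /coord_rV in_itv /= andbT => cx.
      have d0 : 0 < (x ord0 i - c) / h by rewrite divr_gt0// subr_gt0.
      have [k hk] : exists k, 1 < 2 ^+ k * ((x ord0 i - c) / h).
        exists (Num.bound ((x ord0 i - c) / h)^-1); rewrite -ltr_pdivrMr// mul1r.
        apply: lt_le_trans (archi_boundP _) _; first by rewrite invr_ge0 ltW.
        by rewrite -natrX ler_nat ltnW// ltn_expl.
      exists k => //=; rewrite mxE -lezD1 floor_ge_int intrD.
      have := floor_le (2 ^+ k * c / h); move: hk.
      have -> : 2 ^+ k * ((x ord0 i - c) / h) = 2 ^+ k * x ord0 i / h - 2 ^+ k * c / h by ring.
      lra.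
    move=> [k _ /=]; rewrite mxE in_itv /= andbT /coord_rV => H.
    rewrite ltNge; apply/negP => xc; move: H; apply/negP; rewrite -leNgt.
    by apply: le_floor; rewrite ler_pM2r ?invr_gt0// ler_pM2l// exprn_gt0.
move=> /(_ Y) H; apply: (H _).2.
by have := mY; rewrite RGenOInfty.measurableE.
Qed.

End approximation.

End grids.

(** * Almost everywhere signs from integrals over cells *)

Section cell_sign.
Context {R : realType} {n : nat}.
Local Notation lam := (lebesgue_rV R n).
Local Open Scope ereal_scope.

Lemma integral_grid_ge0 (h : R) k (T : set 'rV[int]_n) (w : 'rV[R]_n -> \bar R) :
  (0 < h)%R -> lam.-integrable setT w ->
  (forall s, T s -> 0 <= \int[lam]_(x in cell h k s) w x) ->
  0 <= \int[lam]_(x in grid h k @^-1` T) w x.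
Proof.
move=> h0 iw Hc.
pose F (i : nat) : set 'rV[R]_n :=
  if pickle_inv i is Some s then (if asbool (T s) then cell h k s else set0) else set0.
have FE : grid h k @^-1` T = \bigcup_i F i.
  apply/seteqP; split => x /=.
    move=> Tx; exists (pickle (grid h k x)) => //; rewrite /F pickleK_inv.
    by case: asboolP.
  move=> [i _]; rewrite /F; case: pickle_inv => // s; case: asboolP => // Ts.
  by rewrite /cell /= => ->.
have mF i : measurable (F i).
  rewrite /F; case: pickle_inv => // s; case: asboolP => // _.
  exact: measurable_cell.
rewrite FE integral_bigcup//.
- apply: nneseries_ge0 => i _ _; rewrite /F.
  case: pickle_inv => [s|]; last by rewrite integral_set0.
  by case: asboolP => [Ts|_]; [exact: Hc|rewrite integral_set0].
- move=> i j _ _ [x []]; rewrite /F.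
  case ei : (pickle_inv i) => [s|]//; case: asboolP => // _.
  case ej : (pickle_inv j) => [s'|]//; case: asboolP => // _.
  rewrite /cell /= => -> ss'.
  have := @pickle_invK 'rV[int]_n i; have := @pickle_invK 'rV[int]_n j.
  by rewrite ei ej /= -ss' => -> ->.
- by apply: (integrableS measurableT) => //; exact: bigcupT_measurable.
Qed.

(** Takes the place of Lebesgue differentiation, without covering or maximal arguments. Let [E] be
    the set where [w] is negative and [mu] the measure of density [|w|]. A union [S] of cells close
    to [E] has a nonnegative integral, so the mass of [E] inside [S] is at most that of [S] outside
    [E], which is small; hence [mu E = 0]. *)
Lemma cells_ge0_ae (h : R) (t : 'rV[int]_n) (v : 'rV[R]_n -> R) : (0 < h)%R ->
  lam.-integrable (cell h 0 t) (EFin \o v) ->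
  (forall k s, cell h k s `<=` cell h 0 t -> 0 <= \int[lam]_(x in cell h k s) (v x)%:E) ->
  {ae lam, forall x, cell h 0 t x -> (0 <= v x)%R}.
Proof.
move=> h0 iv Hv; set Q := cell h 0 t; have mQ : measurable Q by exact: measurable_cell.
pose w : 'rV[R]_n -> \bar R := (EFin \o v) \_ Q.
have iw : lam.-integrable setT w by exact/(integrable_mkcond _ mQ).
have mw : measurable_fun [set: 'rV[R]_n] w by exact: measurable_int iw.
have wE x : Q x -> w x = (v x)%:E by move=> Qx; rewrite /w patchE mem_set.
have w0 x : ~ Q x -> w x = 0 by move=> Qx; rewrite /w patchE memNset.
have ia := integrable_abse iw.
have pos A : 0 <= induced_charge ia A by apply: integral_ge0 => x _; exact: abse_ge0.
pose mu := measure_of_charge (induced_charge ia) pos.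
have muE A : mu A = \int[lam]_(x in A) `|w x| by [].
have mufin : mu setT < +oo by rewrite muE; have /integrableP[] := iw.
pose E := [set x | w x < 0].
have mE : measurable E.
  by rewrite -[E]setTI; exact: emeasurable_fun_infty_o.
have EQ : E `<=` Q.
  by move=> x; apply: contraPP => /w0; rewrite /E /= => ->; rewrite ltxx.
have muE0 : mu E = 0.
  apply/eqP; rewrite eq_le measure_ge0 andbT; apply/lee_addgt0Pr => e e0.
  have e20 : (0 < e / 2)%R by rewrite divr_gt0.
  have [k [T hT]] := grid_approximation h0 mufin mE e20.
  set S := grid h k @^-1` T in hT; have mS : measurable S by exact: measurable_grid.
  (* The approximating union may leave [Q]; as [Q] is itself a union of cells of level [k], their
     intersection still is one. *)
  have [T' eQ] := @grid_refine R n h 0 k [set t] (leq0n k).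
  have : 0 <= \int[lam]_(x in Q `&` S) w x.
    rewrite (_ : Q `&` S = grid h k @^-1` (T' `&` T)); last first.
      by rewrite preimage_setI -eQ.
    apply: integral_grid_ge0 => // s [T's Ts].
    have sQ : cell h k s `<=` Q.
      by rewrite /Q /cell eQ => x /= ->.
    by rewrite (eq_integral (EFin \o v)) ?Hv// => x /set_mem/sQ/wE.
  have -> : Q `&` S = (E `&` S) `|` ((Q `&` S) `\` E).
    apply/seteqP; split => x /=; rewrite /setD/=; last by have := EQ x; tauto.
    have := pselect (E x); tauto.
  have mQS : measurable (Q `&` S `\` E) by apply: measurableD => //; exact: measurableI.
  have mES : measurable (E `&` S) by exact: measurableI.
  rewrite integral_setU//=; last 2 first.
  - exact: measurable_funTS.
  - by apply/disj_setPS => x [[Ex _] [_ /(_ Ex)]].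
  have -> : \int[lam]_(x in E `&` S) w x = - mu (E `&` S).
    rewrite muE -integralN /=; last first.
      apply: integrable_add_def => //.
      exact: (integrableS measurableT mES (@subsetT _ _) ia).
    by apply: eq_integral => x /set_mem[Ex _]; rewrite lte0_abs ?oppeK.
  have muSE : \int[lam]_(x in Q `&` S `\` E) w x <= mu (S `\` E).
    apply: (@le_trans _ _ (mu (Q `&` S `\` E))).
      rewrite muE; apply: le_integral => //.
      - exact: (integrableS measurableT mQS (@subsetT _ _) iw).
      - exact: (integrableS measurableT mQS (@subsetT _ _) ia).
      - by move=> x _; exact: lee_abs.
    apply: le_measure; rewrite ?inE//; first exact: measurableD.
    by move=> x [[_ Sx] Ex].
  have finS : mu (S `\` E) <= (e / 2)%:E.
    apply: le_trans hT; apply: le_measure; rewrite ?inE//.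
    - exact: measurableD.
    - by apply: measurableU; exact: measurableD.
  have finE : mu (E `\` S) <= (e / 2)%:E.
    apply: le_trans hT; apply: le_measure; rewrite ?inE//.
    - exact: measurableD.
    - by apply: measurableU; exact: measurableD.
  have fE : mu (E `&` S) \is a fin_num.
    rewrite ge0_fin_numE//; apply: le_lt_trans mufin.
    by apply: le_measure; rewrite ?inE.
  rewrite addeC sube_ge0 ?fE// => H; have {}H : mu (E `&` S) <= (e / 2)%:E.
    by apply: le_trans finS; apply: le_trans muSE.
  rewrite add0e -[leLHS](_ : mu ((E `&` S) `|` (E `\` S)) = _); last first.
    by congr (mu _); rewrite setUIDK.
  apply: le_trans (measureU2 mu mES (measurableD mE mS)) _.
  by rewrite [e in leRHS](_ : e = e / 2 + e / 2)%R ?EFinD ?leeD//; lra.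
have /(ae_eq_integral_abs lam mE) : \int[lam]_(x in E) `|w x| = 0 by rewrite -muE.
move=> /(_ (measurable_funTS mw)); apply: filterS => x /= Ewx Qx.
rewrite leNgt; apply/negP => vx; have Ex : E x by rewrite /E /= wE ?lte_fin.
by have := Ewx Ex; rewrite wE// => -[] v0; rewrite v0 ltxx in vx.
Qed.

End cell_sign.

(** * Smooth functions and derivatives *)

Section derivatives.
Context {R : realType}.

(** Reduces directional derivatives to one variable, so that the chain rule below needs derivability
    along a line only, not total differentiability. *)
Lemma is_derive_line (V : normedModType R) (f : V -> R) (x v : V) (df : R) :
  is_derive x v f df <-> is_derive (0 : R) 1 (fun h => f (h *: v + x)) df.
Proof.
have E : (fun h : R => h^-1 *: ((f \o shift x) (h *: v) - f x)) =
    (fun h : R => h^-1 *: (((fun h => f (h *: v + x)) \o shift 0) (h *: 1) -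
      f (0 *: v + x))).
  by apply/funext => h /=; rewrite scale0r add0r addr0 [h *: 1]mulr1.
split=> -[fx <-].
  by apply: DeriveDef; [move: fx; rewrite /derivable E|rewrite /derive E].
by apply: DeriveDef; [move: fx; rewrite /derivable E|rewrite /derive E].
Qed.

Lemma is_derive_val (V : normedModType R) (f : V -> R) (x v : V) (df df' : R) :
  is_derive x v f df -> df = df' -> is_derive x v f df'.
Proof. by move=> h <-. Qed.

Lemma is_derive_add (V : normedModType R) (f g : V -> R) (x v : V) (df dg : R) :
  is_derive x v f df -> is_derive x v g dg ->
  is_derive x v (fun y => f y + g y) (df + dg).
Proof. by move=> hf hg; exact: (is_deriveD hf hg). Qed.

Lemma is_derive_sub (V : normedModType R) (f g : V -> R) (x v : V) (df dg : R) :
  is_derive x v f df -> is_derive x v g dg ->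
  is_derive x v (fun y => f y - g y) (df - dg).
Proof. by move=> hf hg; exact: (is_deriveB hf hg). Qed.

Lemma is_derive_mul (V : normedModType R) (f g : V -> R) (x v : V) (df dg : R) :
  is_derive x v f df -> is_derive x v g dg ->
  is_derive x v (fun y => f y * g y) (f x * dg + g x * df).
Proof. by move=> hf hg; exact: (is_deriveM hf hg). Qed.

Lemma is_derive_scale (V : normedModType R) (f : V -> R) (x v : V) (c df : R) :
  is_derive x v f df -> is_derive x v (fun y => c * f y) (c * df).
Proof. by move=> hf; exact: (is_deriveZ c hf). Qed.

Lemma is_derive_const (V : normedModType R) (c : R) (x v : V) :
  is_derive x v (fun=> c) 0.
Proof. exact: is_derive_cst. Qed.

Lemma is_derive_var (x : R) : is_derive x 1 (fun t : R => t) 1.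
Proof. exact: is_derive_id. Qed.

Lemma is_derive_comp1 (V : normedModType R) (f : V -> R) (g : R -> R) (x v : V)
    (df dg : R) : is_derive x v f df -> is_derive (f x) 1 g dg ->
  is_derive x v (fun y => g (f y)) (dg * df).
Proof.
move=> /is_derive_line fx gx; apply/is_derive_line.
apply: (@is_derive1_comp R g (fun h => f (h *: v + x)) 0 dg df) => //.
by rewrite scale0r add0r.
Qed.

Lemma is_derive1_continuous (f : R -> R) (x df : R) :
  is_derive x 1 f df -> {for x, continuous f}.
Proof.
by move=> [fx _]; apply: differentiable_continuous; apply/derivable1_diffP.
Qed.

(** The functions s^(-k) exp(-1/s), extended by 0. All derivatives of the standard flat function are
    combinations of them, and each is bounded. *)
Definition flat (k : nat) (s : R) : R :=
  if 0 < s then s^-1 ^+ k * expR (- s^-1) else 0.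

Lemma flatE k s : 0 < s -> flat k s = s^-1 ^+ k * expR (- s^-1).
Proof. by rewrite /flat => ->. Qed.

Lemma flat_ge0 k s : 0 <= flat k s.
Proof.
rewrite /flat; case: ifP => // s0.
by rewrite mulr_ge0 ?expR_ge0// exprn_ge0// invr_ge0 ltW.
Qed.

Lemma flat_le0 k s : s <= 0 -> flat k s = 0.
Proof. by rewrite /flat ltNge => ->. Qed.

(** With t = 1/s this reads t^k <= k! exp t, a single term of the exponential series. *)
Lemma flat_le_fact k s : flat k s <= k`!%:R.
Proof.
have [s0|s0] := leP s 0; first by rewrite flat_le0.
have t0 : 0 <= s^-1 by rewrite invr_ge0 ltW.
rewrite flatE// expRN ler_pdivrMr ?expR_gt0//.
case: k => [|k]; first by rewrite expr0 fact0 mul1r -expR0 ler_expR.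
rewrite -ler_pdivrMl ?ltr0n ?fact_gt0// mulrC.
by have := expR_ge1Dxn k t0; lra.
Qed.

Lemma flatS k s : s * flat k.+1 s = flat k s.
Proof.
have [s0|s0] := leP s 0; first by rewrite !flat_le0// mulr0.
by rewrite !flatE// exprS -mulrA mulVKf// gt_eqF.
Qed.

Lemma is_derive_flat (k : nat) (s : R) : is_derive s 1 (flat k) (flat k.+2 s - k%:R * flat k.+1 s).
Proof.
have [s0|s0|->] := ltgtP s 0.
- rewrite !flat_le0 ?ltW// mulr0 subr0.
  apply: (@near_eq_is_derive _ _ _ (cst 0)).
    near=> t; rewrite flat_le0// ltW//; near: t; exact: lt_nbhsl.
- apply: (@near_eq_is_derive _ _ _ (fun t : R => t^-1 ^+ k * expR (- t^-1))).
    near=> t; rewrite flatE//; near: t; exact: lt_nbhsr.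
  have sn0 : s != 0 by rewrite gt_eqF.
  have dV : is_derive s 1 (fun t : R => t^-1) (- s^-1 ^+ 2).
    apply: (is_derive_val (@is_deriveV _ id _ _ _ sn0 (is_derive_id _ _))).
    by rewrite /GRing.scale /= mulr1 exprVn.
  have dX : is_derive s 1 (fun t : R => t^-1 ^+ k) (- k%:R * s^-1 ^+ k.+1).
    rewrite (_ : (fun t : R => _) = (fun t : R => t^-1) ^+ k); last first.
      by apply/funext => t; rewrite exprfctE.
    apply: (is_derive_val (is_deriveX k dV)).
    rewrite /GRing.scale /=; case: k => [|k]; first by rewrite !mul0r oppr0 mul0r.
    by rewrite !exprS expr0 /=; ring.
  have dE : is_derive s 1 (fun t : R => expR (- t^-1)) (expR (- s^-1) * s^-1 ^+ 2).
    apply: (@is_derive_comp1 _ (fun t : R => - t^-1)).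
    by apply: (is_derive_val (is_deriveN dV)); rewrite opprK.
  apply: (is_derive_val (is_deriveM dX dE)).
  by rewrite /GRing.scale /= !flatE// !exprS expr0; ring.
(* At 0 the difference quotient is [flat k.+1 h], which equals [h * flat k.+2 h] and so is at most a
   constant times |h|. *)
- have f0 j : flat j 0 = 0 by rewrite flat_le0.
  have L : (fun h : R => h^-1 *: ((flat k \o shift (0 : R)) (h *: (1 : R)) -
      flat k 0)) @ (0 : R)^' --> (0 : R).
    apply/cvgrPdist_le => e e0; near=> h.
    rewrite /= f0 subr0 addr0 /GRing.scale /= mulr1 sub0r normrN.
    rewrite -(flatS k h) -(flatS k.+1 h).
    have hn0 : h != 0 by near: h; exact: nbhs_dnbhs_neq.
    rewrite mulKf// normrM (ger0_norm (flat_ge0 _ _)).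
    apply: (@le_trans _ _ (`|h| * (k.+2)`!%:R)).
      by rewrite ler_wpM2l// flat_le_fact.
    rewrite -ler_pdivlMr ?ltr0n ?fact_gt0//.
    near: h; apply: dnbhs0_le.
    by rewrite divr_gt0// ltr0n fact_gt0.
  rewrite !f0 mulr0 subr0; apply: DeriveDef; last exact: (cvg_lim _ L).
  by apply: cvgP L.
Unshelve. all: by end_near. Qed.

Lemma flat_continuous k : continuous (flat k).
Proof. by move=> s; exact: is_derive1_continuous (is_derive_flat k s). Qed.

End derivatives.

Section smooth_expressions.
Context {R : realType} {n : nat}.
Implicit Types (U : set 'rV[R]_n) (f g : 'rV[R]_n -> R).
Local Notation e := (delta_mx ord0).

(* A syntactic class of functions that is visibly closed under partial derivatives. *)
Inductive smooth_expr U : ('rV[R]_n -> R) -> Prop :=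
| SmoothCst c : smooth_expr U (fun=> c)
| SmoothCoord i : smooth_expr U (fun x => x ord0 i)
| SmoothAdd f g : smooth_expr U f -> smooth_expr U g ->
    smooth_expr U (fun x => f x + g x)
| SmoothMul f g : smooth_expr U f -> smooth_expr U g ->
    smooth_expr U (fun x => f x * g x)
| SmoothFlat k f : smooth_expr U f -> smooth_expr U (fun x => flat k (f x))
| SmoothPow r f : smooth_expr U f -> (forall x, U x -> 0 < f x) ->
    smooth_expr U (fun x => f x `^ r).

Lemma smooth_expr_continuous U f : smooth_expr U f ->
  forall x, U x -> {for x, continuous f}.
Proof.
elim=> {f} [c|i|f g _ cf _ cg|f g _ cf _ cg|k f _ cf|r f _ cf f0] x Ux.
- exact: cst_continuous.
- exact: coord_continuous.
- by apply: continuousD; [exact: cf|exact: cg].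
- by apply: continuousM; [exact: cf|exact: cg].
- by apply: (@continuous_comp _ _ _ f (flat k)); [exact: cf|exact: flat_continuous].
- apply: (@continuous_comp _ _ _ f (fun t => t `^ r)); first exact: cf.
  by apply: is_derive1_continuous; exact: is_derive1_powR (f0 x Ux).
Qed.

Lemma is_derive_coord (x : 'rV[R]_n) (i j : 'I_n) :
  is_derive x (e i) (fun y : 'rV[R]_n => y ord0 j) (j == i)%:R.
Proof.
apply/is_derive_line.
rewrite (_ : (fun h => _) = (fun h : R => (j == i)%:R * h + x ord0 j)); last first.
  by apply/funext => h; rewrite !mxE eqxx mulrC.
apply: (is_derive_val (is_derive_add (is_derive_scale _ (is_derive_id _ _))
  (is_derive_cst _ _ _))).
by rewrite mulr1 addr0.
Qed.

Lemma smooth_expr_derive U f : smooth_expr U f -> forall i, exists g,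
  smooth_expr U g /\ forall x, U x -> is_derive x (e i) f (g x).
Proof.
elim=> {f} [c|j|f g sf df sg dg|f g sf df sg dg|k f sf df|r f sf df f0] i.
- by exists (fun=> 0); split=> [|x _]; [exact: SmoothCst|exact: is_derive_cst].
- exists (fun=> (j == i)%:R); split=> [|x _]; first exact: SmoothCst.
  exact: is_derive_coord.
- have [f' [sf' df']] := df i; have [g' [sg' dg']] := dg i.
  exists (fun x => f' x + g' x); split=> [|x Ux]; first exact: SmoothAdd.
  by apply: is_derive_add; [exact: df'|exact: dg'].
- have [f' [sf' df']] := df i; have [g' [sg' dg']] := dg i.
  exists (fun x => f x * g' x + g x * f' x); split=> [|x Ux].
    by apply: SmoothAdd; exact: SmoothMul.
  by apply: is_derive_mul; [exact: df'|exact: dg'].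
- have [f' [sf' df']] := df i.
  exists (fun x => (flat k.+2 (f x) + (- k%:R) * flat k.+1 (f x)) * f' x); split=> [|x Ux].
    apply: SmoothMul => //; apply: SmoothAdd; first exact: SmoothFlat.
    by apply: SmoothMul; [exact: SmoothCst|exact: SmoothFlat].
  apply: is_derive_comp1; first exact: df'.
  by rewrite mulNr; exact: is_derive_flat.
- have [f' [sf' df']] := df i.
  exists (fun x => (r * f x `^ (r - 1)) * f' x); split=> [|x Ux].
    apply: SmoothMul => //; apply: SmoothMul; first exact: SmoothCst.
    exact: SmoothPow.
  by apply: (@is_derive_comp1 _ _ f (fun t => t `^ r)); [exact: df'|exact: is_derive1_powR (f0 x Ux)].
Qed.

Definition smooth_on U f := forall s x, U x ->
  {for x, continuous (partials s f)} /\
  forall i, derivable (partials s f) x (e i).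

(** Agreement on the open set [U] is enough because derivatives are local; this admits functions
    defined by cases, such as [barrier_test]. *)
Lemma smooth_expr_on U f g : open U -> smooth_expr U g ->
  (forall x, U x -> f x = g x) -> smooth_on U f.
Proof.
move=> oU sg fg.
have nU x : U x -> \forall y \near x, U y by move=> Ux; exact: open_nbhs_nbhs.
have P s : exists h, smooth_expr U h /\ forall x, U x -> partials s f x = h x.
  elim: s => [|i s [h [sh fh]]]; first by exists g.
  have [h' [sh' dh']] := smooth_expr_derive sh i.
  exists h'; split=> // x Ux; rewrite /= /partial.
  have [_ <-] := dh' x Ux; apply: near_eq_derive.
  by near=> y; apply: fh; near: y; exact: nU.
move=> s x Ux; have [h [sh fh]] := P s.
have eq_near : \forall y \near x, h y = partials s f y.
  by near=> y; apply/esym/fh; near: y; exact: nU.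
split=> [|i].
  change (partials s f @ x --> partials s f x); rewrite fh//.
  exact: cvg_trans (near_eq_cvg eq_near) (smooth_expr_continuous sh Ux).
have [h' [sh' dh']] := smooth_expr_derive sh i.
by have [+ _] := dh' x Ux; apply: near_eq_derivable.
Unshelve. all: by end_near. Qed.

Lemma smooth_onP f : (forall x, exists2 U, U x & smooth_on U f) -> smooth f.
Proof.
by move=> H s; split=> [x|i x]; have [U Ux /(_ s x Ux)[h1 h2]] := H x.
Qed.

Lemma laplacianE U f (f1 f2 : 'I_n -> 'rV[R]_n -> R) : open U ->
  (forall i x, U x -> is_derive x (e i) f (f1 i x)) ->
  (forall i x, U x -> is_derive x (e i) (f1 i) (f2 i x)) ->
  forall x, U x -> laplacian f x = \sum_i f2 i x.
Proof.
move=> oU d1 d2 x Ux; apply: eq_bigr => i _; rewrite {1}/partial.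
have [_ <-] := d2 i x Ux; apply: near_eq_derive.
near=> y; have Uy : U y by near: y; apply: open_nbhs_nbhs; split.
by rewrite /partial; have [_ ->] := d1 i y Uy.
Unshelve. all: by end_near. Qed.

End smooth_expressions.

Section powers.
Context {R : realType}.

Lemma powRN_anti (r s t : R) : 0 <= r -> 0 < s -> s <= t -> t `^ (- r) <= s `^ (- r).
Proof.
move=> r0 s0 st; have t0 := lt_le_trans s0 st.
rewrite !powRN lef_pV2 ?posrE ?powR_gt0//.
by apply: ge0_ler_powR => //; rewrite nnegrE ltW.
Qed.

Lemma powRN_anti_inv (r s t : R) : 0 < r -> 0 < s -> 0 < t ->
  t `^ (- r) < s -> s `^ (- r^-1) < t.
Proof.
move=> r0 s0 t0 ts; rewrite ltNge; apply/negP => h.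
have := @powRN_anti r _ _ (ltW r0) t0 h.
rewrite -powRrM mulrNN mulVf ?gt_eqF// (powRr1 (ltW s0)) => h2.
by have := le_lt_trans h2 ts; rewrite ltxx.
Qed.

Lemma powRS (s r : R) : 0 < s -> s * s `^ (r - 1) = s `^ r.
Proof.
move=> s0; rewrite -{1}(powRr1 (ltW s0)) -powRD; last by rewrite (gt_eqF s0) implybT.
by congr (_ `^ _); ring.
Qed.

End powers.

(** * Radial functions and their Laplacian *)

Section radial_derivatives.
Context {R : realType} {n : nat}.
Implicit Types (x y : 'rV[R]_n).
Local Notation e := (delta_mx ord0).

(** Radial functions are written in the squared distance, a polynomial, so that nothing has to be
    checked at the centre. *)
Definition sqdist y x : R := \sum_(i < n) (x ord0 i - y ord0 i) ^+ 2.

Lemma sqdist_ge0 y x : 0 <= sqdist y x.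
Proof. by apply: sumr_ge0 => i _; exact: sqr_ge0. Qed.

Lemma sqdist0_gt0 x : x != 0 -> 0 < sqdist 0 x.
Proof.
move=> x0; rewrite lt_neqAle sqdist_ge0 andbT eq_sym; apply: contra x0.
rewrite psumr_eq0 => [/allP h|i _]; last exact: sqr_ge0.
apply/eqP/rowP => i; have := h i (mem_index_enum _).
by rewrite sqrf_eq0 mxE subr0 => /eqP.
Qed.

Lemma enormE x : enorm x = Num.sqrt (sqdist 0 x).
Proof. by congr Num.sqrt; apply: eq_bigr => i _; rewrite mxE subr0. Qed.

Lemma enorm_powR x (r : R) : enorm x `^ r = sqdist 0 x `^ (r / 2).
Proof. by rewrite enormE -powR12_sqrt ?sqdist_ge0// -powRrM mulrC. Qed.

Lemma is_derive_sumf (V : normedModType R) (I : Type) (s : seq I) (f : I -> V -> R)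
    (df : I -> R) (x v : V) : (forall i, is_derive x v (f i) (df i)) ->
  is_derive x v (fun w => \sum_(i <- s) f i w) (\sum_(i <- s) df i).
Proof.
move=> h; elim: s => [|i s IH].
  rewrite big_nil (_ : (fun _ => _) = cst 0); last by apply/funext => w; rewrite big_nil.
  exact: is_derive_cst.
rewrite big_cons (_ : (fun _ => _) = (fun w => f i w + \sum_(j <- s) f j w)); last first.
  by apply/funext => w; rewrite big_cons.
exact: is_derive_add.
Qed.

Lemma is_derive_shift_coord x y i j :
  is_derive x (e i) (fun z : 'rV[R]_n => z ord0 j - y ord0 j) (j == i)%:R.
Proof.
apply: (is_derive_val (is_derive_add (is_derive_coord x i j) (is_derive_cst _ _ _))).
by rewrite addr0.
Qed.

Lemma is_derive_sqdist y x i :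
  is_derive x (e i) (sqdist y) (2 * (x ord0 i - y ord0 i)).
Proof.
rewrite (_ : 2 * _ = \sum_(j < n) 2 * (x ord0 j - y ord0 j) * (j == i)%:R); last first.
  rewrite (bigD1 i)//= eqxx mulr1 big1 ?addr0// => j /negPf ->.
  by rewrite mulr0.
apply: is_derive_sumf => j.
have h := is_derive_shift_coord x y i j.
rewrite (_ : (fun _ => _) = (fun z : 'rV[R]_n =>
  (z ord0 j - y ord0 j) * (z ord0 j - y ord0 j))); last first.
  by apply/funext => z; rewrite expr2.
by apply: (is_derive_val (is_derive_mul h h)); ring.
Qed.

Section profile.
Variables (y : 'rV[R]_n) (A A1 A2 : R -> R) (x : 'rV[R]_n).

Lemma is_derive_radial i : is_derive (sqdist y x) 1 A (A1 (sqdist y x)) ->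
  is_derive x (e i) (fun z => A (sqdist y z))
    (A1 (sqdist y x) * (2 * (x ord0 i - y ord0 i))).
Proof. by move=> hA; apply: is_derive_comp1 => //; exact: is_derive_sqdist. Qed.

Lemma is_derive_radial2 i : is_derive (sqdist y x) 1 A1 (A2 (sqdist y x)) ->
  is_derive x (e i) (fun z => A1 (sqdist y z) * (2 * (z ord0 i - y ord0 i)))
    (A2 (sqdist y x) * (2 * (x ord0 i - y ord0 i)) ^+ 2 + 2 * A1 (sqdist y x)).
Proof.
move=> hA; have h1 : is_derive x (e i) (fun z => A1 (sqdist y z))
    (A2 (sqdist y x) * (2 * (x ord0 i - y ord0 i))).
  by apply: is_derive_comp1 => //; exact: is_derive_sqdist.
have h2 := is_derive_scale 2 (is_derive_shift_coord x y i i).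
by apply: (is_derive_val (is_derive_mul h1 h2)); rewrite eqxx mulr1n; ring.
Qed.

(** This is the radial Laplacian: a profile F of s = |x - y|^2 has Laplacian 4 s F'' + 2 n F'. *)
Lemma sum_radial2 (a1 a2 : R) :
  \sum_(i < n) (a2 * (2 * (x ord0 i - y ord0 i)) ^+ 2 + 2 * a1) =
  4 * sqdist y x * a2 + 2 * n%:R * a1.
Proof.
rewrite big_split /= sumr_const card_ord /sqdist -mulr_natl.
rewrite (eq_bigr (fun i => (4 * a2) * (x ord0 i - y ord0 i) ^+ 2)); last first.
  by move=> i _; ring.
by rewrite -mulr_sumr; ring.
Qed.

End profile.

Lemma smooth_expr_sqdist (U : set 'rV[R]_n) y : smooth_expr U (sqdist y).
Proof.
rewrite /sqdist; elim: (index_enum _) => [|i s IH].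
  rewrite (_ : (fun _ => _) = fun=> 0); last by apply/funext => x; rewrite big_nil.
  exact: SmoothCst.
rewrite (_ : (fun _ => _) = (fun x => (x ord0 i + - y ord0 i) * (x ord0 i + - y ord0 i)
    + \sum_(j <- s) (x ord0 j - y ord0 j) ^+ 2)); last first.
  by apply/funext => x; rewrite big_cons expr2.
apply: SmoothAdd => //.
by apply: SmoothMul; apply: SmoothAdd; (exact: SmoothCoord || exact: SmoothCst).
Qed.

Lemma sqdist_continuous y : continuous (sqdist y).
Proof.
by move=> x; exact: (smooth_expr_continuous (smooth_expr_sqdist setT y)).
Qed.

Lemma sqdist_bounded y (r : R) : bounded_set [set x | sqdist y x <= r].
Proof.
exists (`|y| + (r + 1)); split; first exact: num_real.
move=> M hM x /= xr; apply: (le_trans _ (ltW hM)).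
have r0 : 0 <= r by apply: le_trans xr; exact: sqdist_ge0.
rewrite -[x](subrK y) addrC; apply: (le_trans (ler_normD _ _)).
rewrite lerD2l /normr /= mx_normrE; apply/bigmax_leP => /=; split; first by lra.
move=> [i j] _ /=; rewrite ord1 !mxE.
have : `|x ord0 j - y ord0 j| ^+ 2 <= r.
  rewrite real_normK ?num_real//; apply: le_trans xr.
  by rewrite /sqdist (bigD1 j)//= lerDl sumr_ge0// => k _; exact: sqr_ge0.
have := normr_ge0 (x ord0 j - y ord0 j); move: (`|_|) => t t0 tr.
have [t1|t1] := leP t 1; first by lra.
have : t <= t ^+ 2 by rewrite ler_eXnr//; lra.
lra.
Qed.

Lemma compact_shell y (r s : R) :
  compact [set x | r <= sqdist 0 x /\ sqdist y x <= s].
Proof.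
apply: bounded_closed_compact.
  have [M [Mr HM]] := sqdist_bounded y s.
  by exists M; split=> // M' /HM H x [_ /H].
rewrite (_ : mkset _ = (sqdist 0 @^-1` [set t | r <= t]) `&`
  (sqdist y @^-1` [set t | t <= s])); last by [].
have cl z := (continuous_closedP (sqdist z)).1 (@sqdist_continuous z).
by apply: closedI; apply: cl; [exact: closed_ge|exact: closed_le].
Qed.

Lemma open_punctured : open (@punctured R n).
Proof.
rewrite (_ : punctured = ~` [set 0]); last first.
  by apply/seteqP; split => x /= /eqP.
apply: closed_openC; apply: accessible_closed_set1.
exact/hausdorff_accessible/norm_hausdorff.
Qed.

End radial_derivatives.

(** * The test function *)

Section capped_power.
Context {R : realType}.
Implicit Types (r s : R).

(* A positive smooth function on [0, +oo[ that is the identity on [1, +oo[. *)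
Definition cap s : R := s + flat 0 (1 - s).
Definition cap1 s : R := 1 - flat 2 (1 - s).
Definition cap2 s : R := flat 4 (1 - s) - 2 * flat 3 (1 - s).

Lemma is_derive_flat1B k s :
  is_derive s 1 (fun t : R => flat k (1 - t)) (k%:R * flat k.+1 (1 - s) - flat k.+2 (1 - s)).
Proof.
have h : is_derive s 1 (fun t : R => 1 - t) (-1).
  by apply: (is_derive_val (is_derive_sub (is_derive_const 1 _ _) (is_derive_var s))); rewrite sub0r.
by apply: (is_derive_val (is_derive_comp1 h (is_derive_flat k (1 - s)))); ring.
Qed.

Lemma is_derive_cap s : is_derive s 1 cap (cap1 s).
Proof.
apply: (is_derive_val (is_derive_add (is_derive_var s) (is_derive_flat1B 0 s))).
by rewrite mul0r sub0r.
Qed.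

Lemma is_derive_cap1 s : is_derive s 1 cap1 (cap2 s).
Proof.
apply: (is_derive_val (is_derive_sub (is_derive_const 1 _ _) (is_derive_flat1B 2 s))).
by rewrite /cap2; ring.
Qed.

Lemma cap_ge s : s <= cap s.
Proof. by rewrite lerDl flat_ge0. Qed.

Lemma cap_le s : cap s <= s + 1.
Proof. by rewrite lerD2l; have := flat_le_fact 0 (1 - s); rewrite fact0. Qed.

Lemma cap_id s : 1 <= s -> cap s = s.
Proof. by move=> s1; rewrite /cap flat_le0 ?addr0// subr_le0. Qed.

(** The constant is the value of [flat 0] at 1/2, a lower bound for the flat term when s < 1/2; for
    larger s the linear term suffices. *)
Lemma cap_ge_cst s : 0 <= s -> expR (- 2) <= cap s.
Proof.
move=> s0; have [s2|s2] := leP 2^-1 s.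
  apply: le_trans (cap_ge s); apply: le_trans s2.
  rewrite expRN lef_pV2 ?posrE ?expR_gt0//.
  by have := expR_ge1Dx (2 : R); lra.
apply: (@le_trans _ _ (flat 0 (1 - s))); last by rewrite lerDr.
have h : 2^-1 < 1 - s by lra.
rewrite flatE; last by lra.
by rewrite expr0 mul1r ler_expR lerN2 -[leRHS]invrK lef_pV2 ?posrE//; lra.
Qed.

Lemma cap_gt0 s : 0 <= s -> 0 < cap s.
Proof. by move=> /cap_ge_cst; apply: lt_le_trans; exact: expR_gt0. Qed.

(** The power s^(-r) with its pole smoothed inside s < 1; [cpow1] and [cpow2] are its first two
    derivatives on s >= 0. *)
Definition cpow r s : R := cap s `^ (- r).
Definition cpow1 r s : R := - r * cap s `^ (- r - 1) * cap1 s.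
Definition cpow2 r s : R := - r * ((- r - 1) * cap s `^ (- r - 1 - 1) * cap1 s ^+ 2
  + cap s `^ (- r - 1) * cap2 s).

Lemma is_derive_cpow r s : 0 <= s -> is_derive s 1 (cpow r) (cpow1 r s).
Proof.
by move=> /cap_gt0 /(is_derive1_powR (- r)) h; exact: (is_derive_comp1 (is_derive_cap s) h).
Qed.

Lemma is_derive_cpow1 r s : 0 <= s -> is_derive s 1 (cpow1 r) (cpow2 r s).
Proof.
move=> /cap_gt0 /(is_derive1_powR (- r - 1)) h.
have h' := is_derive_mul (is_derive_comp1 (is_derive_cap s) h) (is_derive_cap1 s).
rewrite (_ : cpow1 r = (fun t => - r * (cap t `^ (- r - 1) * cap1 t))); last first.
  by apply/funext => t; rewrite /cpow1 mulrA.
by apply: (is_derive_val (is_derive_scale (- r) h')); rewrite /cpow2 /=; ring.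
Qed.

Lemma cpow_le r s : 0 <= r -> 0 <= s -> cpow r s <= expR (- 2) `^ (- r).
Proof. by move=> r0 s0; apply: powRN_anti; rewrite ?expR_gt0// cap_ge_cst. Qed.

Lemma cpow_le_pow r s : 0 <= r -> 0 < s -> cpow r s <= s `^ (- r).
Proof. by move=> r0 s0; apply: powRN_anti => //; exact: cap_ge. Qed.

Lemma cpow_ge r s : 0 <= r -> 0 <= s -> (s + 1) `^ (- r) <= cpow r s.
Proof. by move=> r0 s0; apply: powRN_anti => //; [exact: cap_gt0|exact: cap_le]. Qed.

(** The power of [expR (- 2)] bounds that of [cap] with the same exponent; 96 is 4 times 4!, where
    4! bounds [cap2], and 2 n r comes from [cap1 s <= 1]. *)
Definition cpow_bound (n r : R) := expR (- 2) `^ (- r - 1) * (96 * r + 2 * n * r).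

(* [4 s F'' + 2 n F'] is the Laplacian of [F (|x|^2)]; it vanishes where [F] is
   the fundamental solution [s ^ ((2 - n) / 2)]. *)
Lemma cpow_laplacian (n r s : R) : 2 * r = n - 2 -> 0 <= r -> 0 <= s ->
  - (4 * s * cpow2 r s + 2 * n * cpow1 r s) <= cpow_bound n r * (s < 1)%R%:R.
Proof.
move=> nr r0 s0; have [s1|s1] := ltP s 1; last first.
  rewrite mulr0 /cpow1 /cpow2 /cap1 /cap2 !(@flat_le0 _ _ (1 - s)) ?subr_le0//.
  rewrite cap_id// -(@powRS _ s (- r - 1)); last by lra.
  move: (s `^ _) => q.
  have -> : n = 2 * r + 2 by lra.
  by rewrite le_eqVlt; apply/orP; left; apply/eqP; ring.
rewrite mulr1 /cpow_bound.
set M := expR (- 2) `^ _; have M0 : 0 <= M by exact: powR_ge0.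
have qM : cap s `^ (- r - 1) <= M.
  by rewrite /M -opprD; apply: powRN_anti; rewrite ?expR_gt0 ?cap_ge_cst//; lra.
rewrite /cpow1 /cpow2; move: qM; set q := cap s `^ (- r - 1).
set q' := cap s `^ (- r - 1 - 1).
have q0 : 0 <= q by exact: powR_ge0.
have q'0 : 0 <= q' by exact: powR_ge0.
have c1 : cap1 s <= 1 by rewrite /cap1 gerBl flat_ge0.
have c2 : cap2 s <= 24.
  have := flat_ge0 3 (1 - s); have := flat_le_fact 4 (1 - s); rewrite /cap2.
  have -> : (4`!)%:R = 24 :> R by [].
  lra.
move=> qM; have n0 : 0 <= n by lra.
(* The term with the square of [cap1] has the favourable sign and is dropped in the end. *)
have h1 : 0 <= r * (r + 1) * s * q' * cap1 s ^+ 2.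
  by rewrite mulr_ge0 ?sqr_ge0// !mulr_ge0//; lra.
have h2 : s * r * q * cap2 s <= 24 * r * M.
  apply: (@le_trans _ _ (s * r * q * 24)).
    by rewrite ler_wpM2l// !mulr_ge0.
  rewrite mulrC -!mulrA ler_wpM2l//.
  rewrite mulrCA ler_wpM2l//; apply: (@le_trans _ _ q) => //.
  by rewrite ler_piMl// ltW.
have h3 : n * r * q * cap1 s <= n * r * M.
  apply: (@le_trans _ _ (n * r * q * 1)).
    by rewrite ler_wpM2l// !mulr_ge0.
  by rewrite mulr1 ler_wpM2l// mulr_ge0.
have -> : - (4 * s * (- r * ((- r - 1) * q' * cap1 s ^+ 2 + q * cap2 s)) + 2 * n * (- r * q * cap1 s)) =
  - 4 * (r * (r + 1) * s * q' * cap1 s ^+ 2) + 4 * (s * r * q * cap2 s) + 2 * (n * r * q * cap1 s) by ring.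
have -> : M * (96 * r + 2 * n * r) = 4 * (24 * r * M) + 2 * (n * r * M) by ring.
lra.
Qed.

(** A smooth stand-in for the positive part. Its second derivative [flat 3] is nonnegative, which
    disposes of the gradient term in the Laplacian of a composition, and its slope is at most 1, so
    that it does not increase the mass of the pole. *)
Definition bump s : R := s * flat 0 s.
Definition bump1 s : R := flat 0 s + flat 1 s.

Lemma is_derive_bump s : is_derive s 1 bump (bump1 s).
Proof.
apply: (is_derive_val (is_derive_mul (is_derive_var s) (is_derive_flat 0 s))).
by rewrite mul0r subr0 mulr1 flatS addrC.
Qed.

Lemma is_derive_bump1 s : is_derive s 1 bump1 (flat 3 s).
Proof.
apply: (is_derive_val (is_derive_add (is_derive_flat 0 s) (is_derive_flat 1 s))).
by rewrite mul0r subr0 mul1r addrC subrK.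
Qed.

Lemma bump1_ge0 s : 0 <= bump1 s.
Proof. by rewrite addr_ge0// flat_ge0. Qed.

Lemma bump1_le1 s : bump1 s <= 1.
Proof.
rewrite /bump1; have [s0|s0] := leP s 0; first by rewrite !flat_le0// addr0.
rewrite !flatE// expr0 expr1 -mulrDl expRN ler_pdivrMr ?expR_gt0// mul1r.
exact: expR_ge1Dx.
Qed.

Lemma bump_ge0 s : 0 <= bump s.
Proof.
rewrite /bump; have [s0|s0] := leP s 0; first by rewrite flat_le0// mulr0.
by rewrite mulr_ge0 ?flat_ge0// ltW.
Qed.

Lemma flat0_ge s : 1 <= s -> expR (- 1) <= flat 0 s.
Proof.
move=> s1; rewrite flatE; last by lra.
by rewrite expr0 mul1r ler_expR lerN2 invf_le1//; lra.
Qed.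

End capped_power.

Section barrier_test.
Context {R : realType} {n : nat}.
Variables (r : R) (a c d : R) (y : 'rV[R]_n).
Hypotheses (nr : 2 * r = n%:R - 2) (r0 : 0 < r) (a0 : 0 < a) (c0 : 0 < c) (d0 : 0 < d).
Local Notation e := (delta_mx ord0).

(* [a |x - y|^(2-n)] smoothed near [y], minus the strictly superharmonic
   [d |x|^((2-n)/2)], which dominates near the origin and keeps the support of
   [bump \o barrier] away from it. *)
Definition barrier (x : 'rV[R]_n) : R :=
  a * cpow r (c * sqdist y x) - d * sqdist 0 x `^ (- (r / 2)) - 1.

(** The value at 0 is set by hand: 0 to a negative power is 0 by convention, so [barrier] lacks at 0
    the very term that tends to minus infinity there. *)
Definition barrier_test (x : 'rV[R]_n) : R := if x == 0 then 0 else bump (barrier x).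

Let m := r / 2.
Let m0 : 0 < m. Proof. by rewrite divr_gt0. Qed.
Let csq x : 0 <= c * sqdist y x. Proof. by rewrite mulr_ge0 ?sqdist_ge0// ltW. Qed.

Lemma barrier_test_ge0 x : 0 <= barrier_test x.
Proof. by rewrite /barrier_test; case: ifP => // _; exact: bump_ge0. Qed.

(** Where the barrier is positive, the subtracted power stays below the maximum of the smoothed
    pole, which keeps x away from 0 ([rad]), and the pole exceeds 1, which keeps x close to [y]
    ([Rad]). Both bound squared distances. *)
Let rad : R := (a * expR (- 2) `^ (- r) / d) `^ (- m^-1).
Let Rad : R := (a^-1) `^ (- r^-1) / c.

Let barrier_gt0 x : x != 0 -> 0 < barrier x -> rad < sqdist 0 x /\ sqdist y x <= Rad.
Proof.
move=> x0; have t0 := sqdist0_gt0 x0.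
have p0 : 0 <= d * sqdist 0 x `^ (- m) by rewrite mulr_ge0 ?powR_ge0// ltW.
rewrite /barrier -/m => b0; split.
- apply: powRN_anti_inv => //.
    by rewrite divr_gt0// mulr_gt0// powR_gt0// expR_gt0.
  rewrite ltr_pdivlMr// mulrC.
  have : a * cpow r (c * sqdist y x) <= a * expR (- 2) `^ (- r).
    by rewrite (ler_wpM2l (ltW a0))// cpow_le// ltW.
  lra.
- rewrite leNgt; apply/negP; rewrite /Rad ltr_pdivrMr// mulrC => h.
  have i0 : 0 < a^-1 `^ (- r^-1) by rewrite powR_gt0// invr_gt0.
  have : a * cpow r (c * sqdist y x) <= 1.
    rewrite mulrC -ler_pdivlMr// mul1r.
    apply: (le_trans (cpow_le_pow (ltW r0) (lt_trans i0 h))).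
    apply: (le_trans (powRN_anti (ltW r0) i0 (ltW h))).
    by rewrite -powRrM mulrNN mulVf ?gt_eqF// powRr1// invr_ge0 ltW.
  lra.
Qed.

Let rad0 : 0 < rad.
Proof. by rewrite powR_gt0// divr_gt0// mulr_gt0// powR_gt0// expR_gt0. Qed.

Let barrier_test_neq0 x : barrier_test x != 0 -> rad <= sqdist 0 x /\ sqdist y x <= Rad.
Proof.
rewrite /barrier_test; case: ifPn => [_|x0]; first by rewrite eqxx.
have [b0|b0] := leP (barrier x) 0.
  by rewrite /bump flat_le0// mulr0 eqxx.
by have [/ltW ? ?] := barrier_gt0 x0 b0.
Qed.

Lemma smooth_expr_barrier : smooth_expr (@punctured R n) (fun x => bump (barrier x)).
Proof.
have sb : smooth_expr (@punctured R n) barrier.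
  rewrite (_ : barrier = fun x => a * (c * sqdist y x + flat 0 (1 + (- c) * sqdist y x)) `^ (- r)
    + (- d) * sqdist 0 x `^ (- (r / 2)) + -1); last first.
    by apply/funext => x; rewrite /barrier /cpow /cap !mulNr.
  have s1 := smooth_expr_sqdist (@punctured R n).
  apply: SmoothAdd; last exact: SmoothCst.
  apply: SmoothAdd; apply: SmoothMul; try exact: SmoothCst.
    apply: SmoothPow; last first.
      by move=> x _; have := cap_gt0 (csq x); rewrite /cap mulNr.
    apply: SmoothAdd; first by apply: SmoothMul => //; exact: SmoothCst.
    apply: SmoothFlat; apply: SmoothAdd; first exact: SmoothCst.
    by apply: SmoothMul => //; exact: SmoothCst.
  by apply: SmoothPow => // x; exact: sqdist0_gt0.
by apply: SmoothMul => //; exact: SmoothFlat.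
Qed.

Lemma test_function_barrier : test_function (@punctured R n) barrier_test.
Proof.
pose S := [set x : 'rV[R]_n | rad <= sqdist 0 x /\ sqdist y x <= Rad].
have cS : compact S by exact: compact_shell.
have clS : closed S.
  by apply: compact_closed => //; exact: norm_hausdorff.
have supp : closure [set x | barrier_test x != 0] `<=` S.
  rewrite [X in _ `<=` X]((closure_id S).1 clS); apply: closure_subset => x /=.
  exact: barrier_test_neq0.
split.
(* Near 0 the function vanishes identically; elsewhere it is a smooth expression. *)
- apply: smooth_onP => x; case: (eqVneq x 0) => [->|x0].
    exists (sqdist 0 @^-1` [set t | t < rad]).
      by rewrite /= /sqdist big1// => i _; rewrite subrr expr0n.
    apply: (@smooth_expr_on _ _ _ _ (fun=> 0)).
    + apply: open_comp; last exact: open_lt.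
      by move=> z _; exact: sqdist_continuous.
    + exact: SmoothCst.
    + move=> z /= zr; apply/eqP; apply: contraTT zr => /barrier_test_neq0[+ _].
      by rewrite -leNgt.
  exists punctured => //.
  apply: smooth_expr_on smooth_expr_barrier _; first exact: open_punctured.
  by move=> z /= /negPf z0; rewrite /barrier_test z0.
- by apply: subclosed_compact supp => //; exact: closed_closure.
- move=> x /supp[+ _] => h; rewrite /punctured /=; apply/eqP => x0.
  move: h; rewrite x0 /sqdist big1 => [|i _]; last by rewrite subrr expr0n.
  by rewrite leNgt rad0.
Qed.

(** The Laplacian of the composition is [bump1] times that of the barrier plus [flat 3] times a
    squared gradient, and the latter is dropped. The pole contributes only where it has been
    smoothed. The exponent of the subtracted power is midway between 0 and 2-n, those of the
    harmonic powers, which gives the factor r^2. *)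
Lemma barrier_laplacian (x : 'rV[R]_n) : x != 0 ->
  - laplacian barrier_test x <=
    bump1 (barrier x) * (a * c * cpow_bound n%:R r * (c * sqdist y x < 1)%R%:R
      - d * (r ^+ 2 * sqdist 0 x `^ (- (r / 2) - 1))).
Proof.
move=> x0.
pose A1 (s : R) : R := a * c * cpow1 r (c * s); pose A2 (s : R) : R := a * c * c * cpow2 r (c * s).
pose B1 (s : R) : R := d * m * s `^ (- m - 1).
pose B2 (s : R) : R := - (d * m * (m + 1)) * s `^ (- m - 1 - 1).
have dc (s : R) : is_derive s 1 (fun t : R => c * t) c.
  by apply: (is_derive_val (is_derive_scale c (is_derive_var s))); rewrite mulr1.
have dA1 (s : R) : 0 <= c * s -> is_derive s 1 (fun t : R => a * cpow r (c * t)) (A1 s).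
  move=> s0; have h := is_derive_comp1 (dc s) (is_derive_cpow r s0).
  by apply: (is_derive_val (is_derive_scale a h)); rewrite /A1; ring.
have dA2 (s : R) : 0 <= c * s -> is_derive s 1 A1 (A2 s).
  move=> s0; have h := is_derive_comp1 (dc s) (is_derive_cpow1 r s0).
  by apply: (is_derive_val (is_derive_scale (a * c) h)); rewrite /A2; ring.
have dB1 (s : R) : 0 < s -> is_derive s 1 (fun t : R => - d * t `^ (- m)) (B1 s).
  move=> s0; apply: (is_derive_val (is_derive_scale (- d) (is_derive1_powR (- m) s0))).
  by rewrite /B1; ring.
have dB2 (s : R) : 0 < s -> is_derive s 1 B1 (B2 s).
  move=> s0; apply: (is_derive_val (is_derive_scale (d * m) (is_derive1_powR (- m - 1) s0))).
  by rewrite /B2; ring.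
pose W1 (i : 'I_n) (z : 'rV[R]_n) : R := A1 (sqdist y z) * (2 * (z ord0 i - y ord0 i)) +
  B1 (sqdist 0 z) * (2 * (z ord0 i - (0 : 'rV[R]_n) ord0 i)).
pose W2 (i : 'I_n) (z : 'rV[R]_n) : R := (A2 (sqdist y z) * (2 * (z ord0 i - y ord0 i)) ^+ 2 + 2 * A1 (sqdist y z)) +
  (B2 (sqdist 0 z) * (2 * (z ord0 i - (0 : 'rV[R]_n) ord0 i)) ^+ 2 + 2 * B1 (sqdist 0 z)).
have dW1 i (z : 'rV[R]_n) : z != 0 -> is_derive z (e i) barrier (W1 i z).
  move=> z0; rewrite (_ : barrier = fun z => a * cpow r (c * sqdist y z) +
    (- d) * sqdist 0 z `^ (- m) + -1); last first.
    by apply/funext => w; rewrite /barrier mulNr.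
  rewrite -[W1 i z]addr0.
  apply: is_derive_add.
  apply: is_derive_add.
    exact: (@is_derive_radial _ _ y (fun t : R => a * cpow r (c * t)) A1 z i (dA1 _ (csq z))).
  exact: (@is_derive_radial _ _ 0 (fun t : R => - d * t `^ (- m)) B1 z i (dB1 _ (sqdist0_gt0 z0))).
have dW2 i (z : 'rV[R]_n) : z != 0 -> is_derive z (e i) (W1 i) (W2 i z).
  move=> z0; apply: is_derive_add.
    exact: is_derive_radial2 (dA2 _ (csq z)).
  exact: is_derive_radial2 (dB2 _ (sqdist0_gt0 z0)).
pose f1 (i : 'I_n) (z : 'rV[R]_n) : R := bump1 (barrier z) * W1 i z.
pose f2 (i : 'I_n) (z : 'rV[R]_n) : R := bump1 (barrier z) * W2 i z + W1 i z * (flat 3 (barrier z) * W1 i z).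
rewrite (@laplacianE _ _ punctured barrier_test f1 f2 (open_punctured) _ _ x x0); last 2 first.
- move=> i z z0; apply: (@near_eq_is_derive _ _ _ (fun z => bump (barrier z))).
    near=> w; rewrite /barrier_test ifN//; near: w.
    by apply: open_nbhs_nbhs; split => //; exact: open_punctured.
  by apply: is_derive_comp1; [exact: dW1|exact: is_derive_bump].
- move=> i z z0; apply: is_derive_mul; last exact: dW2.
  by apply: is_derive_comp1; [exact: dW1|exact: is_derive_bump1].
rewrite /f2 big_split /= -mulr_sumr /W2 big_split /= !sum_radial2.
have sq : 0 <= \sum_i W1 i x * (flat 3 (barrier x) * W1 i x).
  by apply: sumr_ge0 => i _; rewrite mulrCA mulr_ge0 ?flat_ge0// -expr2 sqr_ge0.
apply: (@le_trans _ _ (- (bump1 (barrier x) *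
  (4 * sqdist y x * A2 (sqdist y x) + 2 * n%:R * A1 (sqdist y x) +
   (4 * sqdist 0 x * B2 (sqdist 0 x) + 2 * n%:R * B1 (sqdist 0 x)))))).
  by rewrite lerN2 lerDl.
rewrite -mulrN ler_wpM2l ?bump1_ge0// opprD lerD//.
- have := cpow_laplacian nr (ltW r0) (csq x).
  have ac : 0 <= a * c by rewrite mulr_ge0// ltW.
  move=> /(ler_wpM2l ac) h.
  rewrite -[leRHS]mulrA (le_trans _ h)// /A1 /A2 le_eqVlt.
  by apply/orP; left; apply/eqP; ring.
- rewrite /B1 /B2 -/m -(@powRS _ (sqdist 0 x) (- m - 1)) ?sqdist0_gt0//.
  have -> : n%:R = 2 * r + 2 :> R by rewrite nr subrK.
  have -> : r = 2 * m by rewrite /m; field.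
  by rewrite le_eqVlt; apply/orP; left; apply/eqP; ring.
Unshelve. all: by end_near. Qed.

End barrier_test.

(** * Lower bounds for supersolutions *)

Section test_functions.
Context {R : realType} {n : nat}.
Implicit Types (D S : set 'rV[R]_n) (u g phi : 'rV[R]_n -> R).
Local Notation lam := (lebesgue_rV R n).

Lemma compact_measurable_rV S : compact S -> measurable S.
Proof. by move=> cS; apply: closed_measurable_rV; exact: compact_closed (@norm_hausdorff _ _) cS. Qed.

Lemma measurable_punctured : measurable (@punctured R n).
Proof. exact: open_measurable_rV (@open_punctured R n). Qed.

Lemma integrable_mul_compact D S u g : measurable D -> compact S -> S `<=` D ->
  loc_integrable D u -> continuous g -> (forall x, ~ S x -> g x = 0) ->
  lam.-integrable D (fun x => (u x * g x)%:E).
Proof.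
move=> mD cS SD [mu iu] cg g0; have mS := compact_measurable_rV cS.
have : lam.-integrable setT ((fun x => (u x * g x)%:E) \_ S).
  apply/(integrable_mkcond _ mS).
  have [M [Mr HM]] : bounded_set (g @` S).
    by apply: compact_bounded; apply: continuous_compact => //; exact: continuous_subspaceT.
  have iuS := iu S SD cS.
  apply: (le_integrable mS _ _ (integrableZl mS (`|M| + 1) iuS)).
    apply/measurable_EFinP; apply: measurable_funM.
      exact: measurable_funS mD SD mu.
    apply: measurable_funTS; apply: continuous_measurable_rV; first exact: openT.
    by move=> x _; exact: cg.
  move=> x Sx /=; rewrite lee_fin !normrM mulrC ler_wpM2r//.
  have h : `|g x| <= `|M| + 1.
    by apply: HM; [have := ler_norm M; lra|exists x].
  by rewrite (le_trans h)// ler_norm.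
move=> /(integrableS measurableT mD (@subsetT _ _)); apply: eq_integrable => // x /set_mem Dx.
rewrite patchE; case: ifPn => // /negP xS; rewrite g0 ?mulr0// => Sx.
by apply: xS; exact: mem_set.
Qed.

Lemma sum_continuous (I : Type) (s : seq I) (h : I -> 'rV[R]_n -> R) :
  (forall i, continuous (h i)) -> continuous (fun x => \sum_(i <- s) h i x).
Proof.
move=> ch; elim: s => [|i s IH].
  rewrite (_ : (fun _ => _) = cst 0); last by apply/funext => x; rewrite big_nil.
  by move=> x; exact: cst_continuous.
rewrite (_ : (fun _ => _) = (fun x => h i x + \sum_(j <- s) h j x)); last first.
  by apply/funext => x; rewrite big_cons.
by move=> x; apply: continuousD; [exact: ch|exact: IH].
Qed.

Lemma smooth_laplacian_continuous phi : smooth phi -> continuous (laplacian phi).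
Proof.
move=> sphi; apply: (@sum_continuous _ _ (fun i => partial i (partial i phi))) => i.
by have [h _] := sphi [:: i; i].
Qed.

Lemma partial_eq0 i phi S : closed S -> (forall x, ~ S x -> phi x = 0) ->
  forall x, ~ S x -> partial i phi x = 0.
Proof.
move=> cS p0 x Sx; rewrite /partial -[RHS](derive_cst (0 : R) x (delta_mx ord0 i)).
apply: near_eq_derive; near=> y; apply: p0; near: y.
by apply: (@open_nbhs_nbhs _ x (~` S)); split => //; exact: closed_openC.
Unshelve. all: by end_near. Qed.

Lemma test_function_laplacian D phi : test_function D phi -> exists S,
  [/\ compact S, S `<=` D, continuous (laplacian phi), continuous phi &
      (forall x, ~ S x -> phi x = 0) /\ (forall x, ~ S x -> laplacian phi x = 0)].
Proof.
move=> [sphi cS SD]; exists (closure [set x | phi x != 0]).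
have p0 x : ~ closure [set x | phi x != 0] x -> phi x = 0.
  move=> nx; apply/eqP; apply: contrapT => /negP px; apply: nx.
  exact: subset_closure.
split => //; first exact: smooth_laplacian_continuous.
  by have [h _] := sphi [::].
split => // x nx; rewrite /laplacian big1// => i _.
have cl : closed (closure [set x | phi x != 0]) by exact: closed_closure.
apply: (@partial_eq0 i (partial i phi) _ cl) => // w nw.
exact: (@partial_eq0 i phi _ cl p0 _ nw).
Qed.

Lemma integrable_loc_subset D S B u : measurable D -> compact S -> S `<=` D ->
  loc_integrable D u -> measurable B -> B `<=` S -> lam.-integrable B (EFin \o u).
Proof.
move=> mD cS SD [mu iu] mB BS.
exact: (integrableS (compact_measurable_rV cS) mB BS (iu S SD cS)).
Qed.

(** Common source of the Green and Harnack bounds: the mass of the pole is charged to [B], and the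
    negative density of the subtracted power is kept on [Q] only. The Green bound takes [kap] = 0
    and keeps the left side; the Harnack bound discards the left side, which is nonnegative. *)
Lemma neg_laplacian_barrier (r a c d kap : R) (y : 'rV[R]_n) u f B Q S :
  2 * r = n%:R - 2 -> 0 < r -> 0 < a -> 0 < c -> 0 < d -> 0 <= kap ->
  loc_integrable (@punctured R n) u -> (forall x, 0 <= u x) ->
  neg_laplacian_ge (@punctured R n) u f ->
  compact S -> S `<=` (@punctured R n) ->
  measurable B -> measurable Q -> B `<=` S -> Q `<=` S ->
  (forall x, c * sqdist y x < 1 -> B x) ->
  (forall x, Q x -> kap <= bump1 (barrier r a c d y x) *
     (d * (r ^+ 2 * sqdist 0 x `^ (- (r / 2) - 1)))) ->
  (\int[lam]_(x in @punctured R n) (f x * barrier_test r a c d y x)%:E <=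
   (a * c * cpow_bound n%:R r)%:E * \int[lam]_(x in B) (u x)%:E -
     kap%:E * \int[lam]_(x in Q) (u x)%:E)%E.
Proof.
move=> nr r0 a0 c0 d0 k0 iu u0 ge cS SD mB mQ BS QS HB HQ.
have tf := test_function_barrier y r0 a0 c0 d0.
apply: (le_trans (ge _ tf (@barrier_test_ge0 _ _ r a c d y))).
have mD := measurable_punctured.
have C0 : 0 <= cpow_bound n%:R r.
  rewrite /cpow_bound mulr_ge0 ?powR_ge0//.
  by rewrite addr_ge0// !mulr_ge0// ltW.
set L := a * c * cpow_bound n%:R r.
have L0 : 0 <= L by apply: mulr_ge0 => //; apply: mulr_ge0; exact: ltW.
have iB := integrable_loc_subset mD cS SD iu mB BS.
have iQ := integrable_loc_subset mD cS SD iu mQ QS.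
have BD := subset_trans BS SD; have QD := subset_trans QS SD.
have res E : E `<=` @punctured R n -> measurable E -> lam.-integrable E (EFin \o u) ->
    lam.-integrable (@punctured R n) ((EFin \o u) \_ E) /\
    (\int[lam]_(x in @punctured R n) ((EFin \o u) \_ E) x = \int[lam]_(x in E) (u x)%:E)%E.
  move=> ED mE /(integrable_mkcond _ mE) iE; split.
    exact: (integrableS measurableT mD (@subsetT _ _) iE).
  by rewrite -integral_mkcondr setIidr.
have [iB' eB] := res _ BD mB iB; have [iQ' eQ] := res _ QD mQ iQ.
have [T [cT TD cl _ [_ T0]]] := test_function_laplacian tf.
rewrite -eB -eQ -integralZl// -integralZl// -integralB//; last 2 first.
- exact: integrableZl.
- exact: integrableZl.
apply: le_integral => //.
- apply: (integrable_mul_compact mD cT TD iu).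
    by move=> x; apply: continuousN; exact: cl.
  by move=> x /T0 ->; rewrite oppr0.
- by apply: integrableB => //; exact: integrableZl.
move=> x /set_mem Dx.
have H := barrier_laplacian d y nr r0 a0 c0 Dx; rewrite -/L in H.
set w := bump1 _ in H; have w0 : 0 <= w by exact: bump1_ge0.
have w1 : w <= 1 by exact: bump1_le1.
set t := d * _ in H; have t0 : 0 <= t.
  by rewrite /t !mulr_ge0 ?powR_ge0// ?sqr_ge0 ltW.
have h1 : w * (L * (c * sqdist y x < 1)%R%:R) <= L * (x \in B)%:R.
  case: ltP => cx; last by rewrite !mulr0 mulr_ge0.
  by rewrite (mem_set (HB _ cx)) !mulr1 ler_piMl.
have h2 : kap * (x \in Q)%:R <= w * t.
  have [/set_mem Qx|_] := boolP (x \in Q); first by rewrite mulr1; exact: HQ.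
  by rewrite mulr0 mulr_ge0.
have Hx : - laplacian (barrier_test r a c d y) x <= L * (x \in B)%:R - kap * (x \in Q)%:R.
  apply: (le_trans H); rewrite mulrBr; lra.
rewrite /= !patchE.
have -> : (L%:E * (if x \in B then (EFin \o u) x else 0) -
    kap%:E * (if x \in Q then (EFin \o u) x else 0))%E =
    (u x * (L * (x \in B)%:R - kap * (x \in Q)%:R))%:E.
  by case: (x \in B); case: (x \in Q); rewrite /= ?mulr1 ?mulr0 ?mule0 -?EFinM -?EFinB; congr _%:E; ring.
by rewrite lee_fin ler_wpM2l.
Qed.

End test_functions.

(** * Averages over cubes *)

Section dyadic_cubes.
Context {R : realType} {n : nat}.
Implicit Types (rho eps M X : R) (x y : 'rV[R]_n) (u f : 'rV[R]_n -> R).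
Local Notation lam := (lebesgue_rV R n).

(** Index (1, ..., 1) gives the product of the intervals [rho, 2 rho[, which avoids the origin.
    Being a cell, it is subdivided exactly by the finer grids. *)
Definition cube rho : set 'rV[R]_n := cell rho 0 (const_mx 1).

Lemma cubeP rho x : 0 < rho -> cube rho x <-> forall i, rho <= x ord0 i < 2 * rho.
Proof.
move=> rho0; rewrite /cube cellE//=; split=> h i; have := h i.
  by rewrite in_itv /= !mxE expr0 divr1 mulr1 [_ * rho]mulrC.
by rewrite in_itv /= !mxE expr0 divr1 mulr1 [_ * rho]mulrC.
Qed.

Lemma measurable_cube rho : 0 < rho -> measurable (cube rho).
Proof. exact: measurable_cell. Qed.

Lemma lebesgue_cube rho : 0 < rho -> lam (cube rho) = (rho ^+ n)%:E.
Proof. by move=> rho0; rewrite /cube lebesgue_cell// expr0 divr1. Qed.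

Lemma cube_sqdist0 rho x : (0 < n)%N -> 0 < rho -> cube rho x ->
  rho ^+ 2 <= sqdist 0 x <= 4 * n%:R * rho ^+ 2.
Proof.
move=> n0 rho0 /(cubeP _ rho0) h.
have b i : rho ^+ 2 <= (x ord0 i - (0 : 'rV[R]_n) ord0 i) ^+ 2 <= 4 * rho ^+ 2.
  rewrite mxE subr0; have /andP[h1 h2] := h i; rewrite !expr2; apply/andP; split; nra.
apply/andP; split.
  rewrite /sqdist (bigD1 (Ordinal n0))//=; have /andP[+ _] := b (Ordinal n0).
  move=> /le_trans; apply; rewrite lerDl sumr_ge0// => i _; exact: sqr_ge0.
apply: (@le_trans _ _ (\sum_(i < n) 4 * rho ^+ 2)).
  by apply: ler_sum => i _; have /andP[] := b i.
by rewrite sumr_const card_ord -[leLHS]mulr_natl mulrCA mulrA.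
Qed.

Lemma cube_sqdist rho rho' M x y : 0 < rho -> 0 < rho' -> rho <= M -> rho' <= M ->
  cube rho y -> cube rho' x -> sqdist y x <= 4 * n%:R * M ^+ 2.
Proof.
move=> r0 r0' rM rM' /(cubeP _ r0) hy /(cubeP _ r0') hx.
apply: (@le_trans _ _ (\sum_(i < n) 4 * M ^+ 2)).
  apply: ler_sum => i _; have /andP[h1 h2] := hx i; have /andP[h3 h4] := hy i.
  rewrite !expr2; nra.
by rewrite sumr_const card_ord -[leLHS]mulr_natl mulrCA mulrA.
Qed.

Lemma cube_punctured rho : (0 < n)%N -> 0 < rho -> cube rho `<=` @punctured R n.
Proof.
move=> n0 rho0 x /(cube_sqdist0 n0 rho0)/andP[h _]; rewrite /punctured /=.
apply: contraTneq h => ->; rewrite -ltNge /sqdist big1 ?exprn_gt0// => i _.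
by rewrite subrr expr0n.
Qed.

Lemma shell_punctured (a b : R) : 0 < a ->
  [set x : 'rV[R]_n | a <= sqdist 0 x /\ sqdist 0 x <= b] `<=` @punctured R n.
Proof.
move=> a0 x [/= h _]; rewrite /punctured /=.
apply: contraTneq h => ->; rewrite -ltNge /sqdist big1// => i _.
by rewrite subrr expr0n.
Qed.

(** [y] is the centre and [eps] half the side: the ball of radius [eps] is inscribed, and (2 eps)^n
    is the volume of the cell. *)
Lemma cell_center rho k t : 0 < rho -> cell rho k t `<=` cube rho ->
  exists y eps, [/\ cube rho y, 0 < eps <= rho, (2 * eps) ^+ n = (rho / 2 ^+ k) ^+ n &
    forall x, (eps ^+ 2)^-1 * sqdist y x < 1 -> cell rho k t x].
Proof.
move=> rho0 tQ; pose w := rho / 2 ^+ k; have w0 : 0 < w by rewrite divr_gt0// exprn_gt0.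
pose y : 'rV[R]_n := \row_i (w * ((t ord0 i)%:~R + 2^-1)); exists y, (w / 2).
have e0 : 0 < w / 2 by rewrite divr_gt0.
split.
- apply: tQ; rewrite cellE// -/w => i /=; rewrite in_itv /= mxE intrD.
  by rewrite ler_pM2l// ltr_pM2l//; apply/andP; split; lra.
- rewrite e0 /= /w ler_pdivrMr// ler_pdivrMr ?exprn_gt0//.
  rewrite -mulrA ler_peMr//; first by rewrite ltW.
  by rewrite -exprS exprn_ege1// ler1n.
- by rewrite -/w mulrC divfK ?pnatr_eq0.
- move=> x; rewrite mulrC ltr_pdivrMr ?exprn_gt0// mul1r => h.
  rewrite cellE// -/w => i /=.
  have : (x ord0 i - y ord0 i) ^+ 2 < (w / 2) ^+ 2.
    apply: le_lt_trans h; rewrite /sqdist (bigD1 i)//= lerDl sumr_ge0// => j _.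
    exact: sqr_ge0.
  rewrite -[X in X < _]real_normK ?num_real// ltr_pXn2r ?nnegrE ?(ltW e0)//.
  rewrite ltr_norml mxE in_itv /= intrD => /andP[h1 h2].
  by apply/andP; split; lra.
Qed.

Definition average rho u : R := fine (\int[lam]_(x in cube rho) (u x)%:E) / rho ^+ n.

Lemma integrable_cube rho u : (0 < n)%N -> 0 < rho -> loc_integrable (@punctured R n) u ->
  lam.-integrable (cube rho) (EFin \o u).
Proof.
move=> n0 rho0 iu.
apply: (@integrable_loc_subset _ _ punctured [set x | rho ^+ 2 <= sqdist 0 x /\
  sqdist 0 x <= 4 * n%:R * rho ^+ 2] _ u) => //.
- exact: measurable_punctured.
- exact: compact_shell.
- by apply: shell_punctured; rewrite exprn_gt0.
- exact: measurable_cube.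
- by move=> x /(cube_sqdist0 n0 rho0)/andP.
Qed.

(** Taking for [B] a subcell with its inscribed ball bounds the average over every subcell, hence
    the function almost everywhere. The factor 2^n is the ratio of the volume (2 eps)^n to eps^n. *)
Lemma cube_lower_bound rho X u : (0 < n)%N -> 0 < rho ->
  loc_integrable (@punctured R n) u ->
  (forall y eps B, cube rho y -> 0 < eps <= rho -> measurable B -> B `<=` cube rho ->
    (forall x, (eps ^+ 2)^-1 * sqdist y x < 1 -> B x) ->
    ((X * eps ^+ n)%:E <= \int[lam]_(x in B) (u x)%:E)%E) ->
  {ae lam, forall x, cube rho x -> X / 2 ^+ n <= u x}.
Proof.
move=> n0 rho0 iu H; have iQ := integrable_cube n0 rho0 iu.
have mQ := measurable_cube rho0.
have fin_cell k t : lam (cell rho k t) \is a fin_num by rewrite lebesgue_cell.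
have icst k t c : lam.-integrable (cell rho k t) (EFin \o (fun=> c)).
  apply/integrableP; split; first exact: measurable_cst.
  rewrite integral_cst//=; last exact: measurable_cell.
  by rewrite lebesgue_cell// -EFinM ltry.
have : {ae lam, forall x, cell rho 0 (const_mx 1) x -> 0 <= u x - X / 2 ^+ n}.
  apply: (@cells_ge0_ae R n rho (const_mx 1) (fun x => u x - X / 2 ^+ n)) => //.
    exact: (integrableB mQ iQ (icst 0%N _ _)).
  move=> k t tQ; have mt := measurable_cell k t rho0.
  have it := integrableS mQ mt tQ iQ.
  rewrite integralB_EFin// (integral_cst _ mt) [X in (_ * X)%E](lebesgue_cell k t rho0).
  have [y [eps [Qy e0 ew HB]]] := cell_center rho0 tQ.
  have := H y eps _ Qy e0 mt tQ HB.
  have ei : 0 < 2 ^+ n :> R by rewrite exprn_gt0.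
  rewrite -ew exprMn -EFinM mulrA divfK ?gt_eqF//.
  by rewrite sube_ge0.
by apply: filterS => x h Qx; rewrite -subr_ge0; exact: h.
Qed.

Lemma average_ge rho X u : (0 < n)%N -> 0 < rho ->
  loc_integrable (@punctured R n) u ->
  {ae lam, forall x, cube rho x -> X <= u x} -> X <= average rho u.
Proof.
move=> n0 rho0 iu H; have iQ := integrable_cube n0 rho0 iu.
have mQ := measurable_cube rho0.
have icst : lam.-integrable (cube rho) (EFin \o (fun=> X)).
  apply/integrableP; split; first exact: measurable_cst.
  by rewrite integral_cst//= lebesgue_cube// -EFinM ltry.
rewrite /average ler_pdivlMr ?exprn_gt0// -lee_fin fineK; last exact: integrable_fin_num.
rewrite EFinM -lebesgue_cube// -integral_cst//.
rewrite -sube_ge0; last first.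
  by rewrite (integral_cst _ mQ) [X in (_ * X)%E](lebesgue_cube rho0).
rewrite -integralB_EFin//.
rewrite (ae_eq_integral (fun x => `|u x - X|%:E)%E)//.
- by apply: integral_ge0 => x _; rewrite lee_fin.
- by have := integrableB mQ iQ icst; exact: measurable_int.
- apply/measurable_EFinP; apply: measurableT_comp => //.
  by apply/measurable_EFinP; have := integrableB mQ iQ icst; exact: measurable_int.
- by apply: filterS H => x h Qx; rewrite ger0_norm ?subr_ge0 ?h.
Qed.

End dyadic_cubes.

(** * Green and Harnack bounds for supersolutions *)

Section superharmonic_bounds.
Context {R : realType} {n : nat}.
Hypothesis n3 : (3 <= n)%N.
Implicit Types (rho eps M X : R) (x y : 'rV[R]_n) (u f : 'rV[R]_n -> R).
Local Notation lam := (lebesgue_rV R n).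
Local Notation D := (@punctured R n).

(** The signs are required at every point; a pair positive almost everywhere is brought to this form
    by absolute values. *)
Definition nonneg_supersolution u f :=
  [/\ loc_integrable D u, (forall x, 0 <= u x), measurable_fun D f,
      (forall x, 0 <= f x) & neg_laplacian_ge D u f].

Let n0 : (0 < n)%N. Proof. exact: leq_trans n3. Qed.
(** Chosen so that [sqdist] to the power -r is the fundamental solution |x - y|^(2-n), up to a
    constant. *)
Let r : R := (n%:R - 2) / 2.
Let nr : 2 * r = n%:R - 2. Proof. by rewrite /r mulrC divfK ?pnatr_eq0. Qed.
Let n3R : 3 <= n%:R :> R. Proof. by rewrite ler_nat. Qed.
Let r0 : 0 < r. Proof. by rewrite divr_gt0//; have := n3R; lra. Qed.
Let N := (n - 2)%N.
Let n2 : n = (N + 2)%N. Proof. by rewrite subnK// ltnW. Qed.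

Let sq_powR M : 0 <= M -> (M ^+ 2) `^ r = M ^+ N.
Proof.
move=> M0; rewrite -powR_mulrn// -powRrM nr -powR_mulrn//; congr (_ `^ _).
by rewrite /N natrB// ltnW.
Qed.

Let G0 : R := (4 * n%:R + 1) `^ r.
Let G0_gt0 : 0 < G0. Proof. by rewrite powR_gt0//; have := n3R; lra. Qed.
Let Cb := cpow_bound n%:R r.
Let Cb0 : 0 < Cb.
Proof.
rewrite /Cb /cpow_bound mulr_gt0 ?powR_gt0 ?expR_gt0//.
by rewrite -mulrDl mulr_gt0//; have := n3R; lra.
Qed.

(** The height at which a pole smoothed at width [eps] behaves like K |x - y|^(2-n) away from [y],
    whatever [eps]. Its Laplacian is then of size K / eps^n on the ball of radius [eps]. *)
Let pole K eps := K * (eps ^+ N)^-1.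

Let pole_bound K eps : 0 < eps -> pole K eps * (eps ^+ 2)^-1 * Cb = K * Cb / eps ^+ n.
Proof.
move=> e0; have -> : eps ^+ n = eps ^+ N * eps ^+ 2 by rewrite -exprD -n2.
by rewrite /pole [in RHS]invfM; move: (eps ^+ N)^-1 (eps ^+ 2)^-1 => s t; ring.
Qed.

(** Uniform in [eps], because |x - y|^2 / eps^2 + 1 is at most (4 n + 1) M^2 / eps^2; the power r of
    4 n + 1 is [G0]. *)
Let pole_ge K rho rho' eps M x y : 0 < K -> 0 < rho -> 0 < rho' -> 0 < eps <= rho ->
  rho <= M -> rho' <= M -> cube rho y -> cube rho' x ->
  K / (G0 * M ^+ N) <= pole K eps * cpow r ((eps ^+ 2)^-1 * sqdist y x).
Proof.
move=> K0 rho0 rho0' /andP[e0 erho] rM rM' Qy Qx.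
have M0 : 0 < M by exact: lt_le_trans rM.
have s0 : 0 <= (eps ^+ 2)^-1 * sqdist y x.
  by rewrite mulr_ge0 ?sqdist_ge0// invr_ge0 exprn_ge0// ltW.
have sM := cube_sqdist rho0 rho0' rM rM' Qy Qx.
rewrite /pole -mulrA ler_pM2l//.
apply: (@le_trans _ _ ((eps ^+ N)^-1 * ((4 * n%:R + 1) * M ^+ 2 / eps ^+ 2) `^ (- r))).
  rewrite powRN powRM; [|by rewrite mulr_ge0 ?exprn_ge0 ?ltW//; have := n3R; lra|by rewrite invr_ge0 exprn_ge0// ltW].
  rewrite powRM; [|have := n3R; lra|by rewrite exprn_ge0// ltW].
  rewrite -(exprVn eps 2) (sq_powR (ltW M0)) sq_powR ?invr_ge0 ?(ltW e0)// -/G0.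
  set g := G0 * _; rewrite exprVn [X in _ <= _ * X]invfM invrK mulrCA mulVf ?mulr1//.
  by rewrite expf_neq0// gt_eqF.
rewrite ler_pM2l ?invr_gt0 ?exprn_gt0//.
apply: (le_trans _ (cpow_ge (ltW r0) s0)).
apply: powRN_anti; [exact: ltW|by have := n3R; lra|].
rewrite -[X in _ + X](@mulVf _ (eps ^+ 2)) ?expf_neq0 ?gt_eqF// -mulrDr mulrC.
rewrite ler_pM2r ?invr_gt0 ?exprn_gt0// mulrDl mul1r lerD//.
by rewrite lerXn2r ?nnegrE ?(ltW e0) ?(ltW M0)// (le_trans erho).
Qed.

(** This is rho^((n-2)/2), the coefficient for which the subtracted power is at most 1 on all cubes
    of size at least [rho]. *)
Let low rho : R := (rho ^+ 2) `^ (r / 2).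

Let low_gt0 rho : 0 < rho -> 0 < low rho.
Proof. by move=> h; rewrite powR_gt0// exprn_gt0. Qed.

Let low_le1 rho rho' x : 0 < rho -> rho <= rho' -> cube rho' x ->
  low rho * sqdist 0 x `^ (- (r / 2)) <= 1.
Proof.
move=> h0 hh Qx; have h0' := lt_le_trans h0 hh.
have /andP[h _] := cube_sqdist0 n0 h0' Qx.
have hs : rho ^+ 2 <= sqdist 0 x.
  by apply: le_trans h; rewrite lerXn2r ?nnegrE ?(ltW h0) ?(ltW h0').
apply: (@le_trans _ _ (low rho * (rho ^+ 2) `^ (- (r / 2)))).
  rewrite ler_pM2l ?low_gt0//; apply: powRN_anti => //; last by rewrite exprn_gt0.
  by rewrite divr_ge0// ltW.
by rewrite powRN /low mulfV// gt_eqF// powR_gt0// exprn_gt0.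
Qed.

Let shell (a b : R) := [set x : 'rV[R]_n | a <= sqdist 0 x /\ sqdist 0 x <= b].

Let cube_shell (m M rho : R) : 0 < m -> m <= rho -> rho <= M ->
  cube rho `<=` shell (m ^+ 2) (4 * n%:R * M ^+ 2).
Proof.
move=> m0 mr rM x Qx; have h0 := lt_le_trans m0 mr; have M0 := lt_le_trans h0 rM.
have /andP[h1 h2] := cube_sqdist0 n0 h0 Qx; split.
  by apply: le_trans h1; rewrite lerXn2r ?nnegrE ?(ltW h0) ?(ltW m0).
apply: (le_trans h2); rewrite ler_pM2l; last by have := n3R; lra.
by rewrite lerXn2r ?nnegrE ?(ltW h0) ?(ltW M0).
Qed.

Definition expcube (k : int) : set 'rV[R]_n := cube (expR k%:~R).

(** The sizes grow by a factor e, which is at least 2. *)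
Let expcube_disj (j k : int) x : expcube j x -> expcube k x -> j = k.
Proof.
wlog jk : j k / (j < k)%R.
  move=> H jx kx; have [jk|kj|//] := ltgtP j k; first exact: H.
  by apply/esym; exact: H.
have e0 (i : int) := expR_gt0 (i%:~R : R).
move=> /(cubeP _ (e0 j))/(_ (Ordinal n0))/andP[_ h1].
move=> /(cubeP _ (e0 k))/(_ (Ordinal n0))/andP[h2 _].
have : (2 : R) * expR j%:~R <= expR k%:~R.
  have jk' : (j%:~R : R) + 1 <= k%:~R.
    by rewrite -[X in _ + X]/(1%:~R) -intrD ler_int lezD1.
  apply: (@le_trans _ _ (expR (j%:~R + 1))); last by rewrite ler_expR.
  rewrite expRD mulrC ler_pM2l//; have := expR_ge1Dx (1 : R); lra.
by move=> h3; have := le_lt_trans h2 h1; rewrite ltNge h3.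
Qed.

(** The sum is a discrete Green potential: a mass F_k e^(kn) on the k-th cube, at a distance of
    order max(e^j, e^k) from the j-th. It matters that [c] is independent of [s], since later
    arbitrarily many scales are inserted. *)
Lemma green_cube : exists2 c : R, 0 < c & forall u f, nonneg_supersolution u f ->
  forall (j : int) (s : seq int) (F : int -> R), uniq s -> (forall k, 0 <= F k) ->
  (forall k, k \in s -> {ae lam, forall x, expcube k x -> F k <= f x}) ->
  {ae lam, forall x, expcube j x ->
    c * \sum_(k <- s) F k * expR k%:~R ^+ n / Num.max (expR j%:~R) (expR k%:~R) ^+ N <= u x}.
Proof.
pose k0 := expR (- 1 : R).
have k0_gt0 : 0 < k0 by exact: expR_gt0.
exists (k0 / (3 * G0 * Cb) / 2 ^+ n).
  apply: divr_gt0; last by rewrite exprn_gt0.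
  by apply: divr_gt0 => //; apply: mulr_gt0 => //; apply: mulr_gt0.
move=> u f [iu u0 mf f0 ge] j s F us F0 HF.
pose rad (k : int) : R := expR k%:~R.
have rad0 k : 0 < rad k by exact: expR_gt0.
set c := _ / _; set Sm := \sum_(k <- s) _; set X := c * 2 ^+ n * Sm.
have -> : c * Sm = X / 2 ^+ n.
  by rewrite /X; field; rewrite expf_neq0 ?pnatr_eq0.
apply: cube_lower_bound => // y eps B Qy eprho mB BQ HB.
have /andP[e0 erho] := eprho.
pose mx k := Num.max (rad j) (rad k).
have mx0 k : 0 < mx k by rewrite lt_max rad0.
(* Any common bound for the sizes will do, here [M] from above and [m] from below: [M] enters
   through [K], which cancels, and [m] only through the cut-off near 0. *)
pose M := rad j + \sum_(k <- s) rad k.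
have radM k : k \in s -> rad k <= M.
  move=> ks; rewrite /M (big_rem k)//= addrCA lerDl addr_ge0 ?(ltW (rad0 _))//.
  by apply: sumr_ge0 => i _; exact: ltW.
have jM : rad j <= M by rewrite lerDl sumr_ge0// => i _; exact: ltW.
have M0 : 0 < M by exact: lt_le_trans jM.
have mxM k : k \in s -> mx k <= M by move=> ks; rewrite ge_max jM radM.
pose m := ((rad j)^-1 + \sum_(k <- s) (rad k)^-1)^-1.
have mi0 : 0 < (rad j)^-1 + \sum_(k <- s) (rad k)^-1.
  by rewrite ltr_wpDr ?invr_gt0// sumr_ge0// => i _; rewrite invr_ge0 ltW.
have m0 : 0 < m by rewrite invr_gt0.
have mrad k : k \in s -> m <= rad k.
  move=> ks; rewrite -[leRHS]invrK lef_pV2 ?posrE ?invr_gt0//.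
  rewrite (big_rem k)//= addrCA lerDl addr_ge0 ?invr_ge0 ?(ltW (rad0 _))//.
  by apply: sumr_ge0 => i _; rewrite invr_ge0 ltW.
have mj : m <= rad j.
  rewrite -[leRHS]invrK lef_pV2 ?posrE ?invr_gt0// lerDl sumr_ge0// => i _.
  by rewrite invr_ge0 ltW.
(* The pole is then at least 3 on each cube; the barrier subtracts at most 1 + 1 from it, so at
   least a third is left. *)
pose K := 3 * G0 * M ^+ N.
have K0 : 0 < K by rewrite !mulr_gt0// exprn_gt0.
have a0 : 0 < pole K eps by rewrite /pole mulr_gt0// invr_gt0 exprn_gt0.
have c0 : 0 < (eps ^+ 2)^-1 by rewrite invr_gt0 exprn_gt0.
have d0 := low_gt0 m0.
have BS : B `<=` shell (m ^+ 2) (4 * n%:R * M ^+ 2).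
  by apply: (subset_trans BQ); apply: cube_shell.
have SD : shell (m ^+ 2) (4 * n%:R * M ^+ 2) `<=` D.
  by apply: shell_punctured; rewrite exprn_gt0.
pose phi := barrier_test r (pole K eps) (eps ^+ 2)^-1 (low m) y.
have H : (\int[lam]_(x in D) (f x * phi x)%:E <=
    (K * Cb / eps ^+ n)%:E * \int[lam]_(x in B) (u x)%:E)%E.
  have := @neg_laplacian_barrier R n r (pole K eps) (eps ^+ 2)^-1 (low m) 0 y u f B
    set0 _ nr r0 a0 c0 d0 (lexx _) iu u0 ge (@compact_shell R n 0 _ _) SD mB measurable0 BS
    (@sub0set _ _) HB.
  by rewrite mul0e sube0 pole_bound//; apply.
have tf := test_function_barrier y r0 a0 c0 d0.
have [_ [_ _ _ cphi _]] := test_function_laplacian tf.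
pose b k := k0 * (K / (3 * (G0 * mx k ^+ N))).
have b0 k : 0 < b k.
  by rewrite /b mulr_gt0// divr_gt0// !mulr_gt0// exprn_gt0.
have phi_ge k x : k \in s -> expcube k x -> b k <= phi x.
  move=> ks Qx; rewrite /phi /barrier_test ifN; last first.
    exact: (cube_punctured n0 (rad0 k) Qx).
  have p1 : K / (G0 * mx k ^+ N) <= pole K eps * cpow r ((eps ^+ 2)^-1 * sqdist y x).
    apply: (@pole_ge K (rad j) (rad k)) => //; first by rewrite le_max lexx.
    by rewrite le_max lexx orbT.
  have p3 : 3 <= K / (G0 * mx k ^+ N).
    rewrite ler_pdivlMr ?mulr_gt0 ?exprn_gt0// /K mulrA ler_pM2l ?mulr_gt0//.
    by rewrite lerXn2r ?nnegrE ?(ltW (mx0 k)) ?(ltW M0) ?mxM.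
  have l1 := low_le1 m0 (mrad k ks) Qx.
  have W1 : K / (3 * (G0 * mx k ^+ N)) <= barrier r (pole K eps) (eps ^+ 2)^-1 (low m) y x.
    have -> : K / (3 * (G0 * mx k ^+ N)) = 3^-1 * (K / (G0 * mx k ^+ N)).
      by rewrite invfM; ring.
    rewrite /barrier; lra.
  have W3 : 1 <= K / (3 * (G0 * mx k ^+ N)).
    have -> : K / (3 * (G0 * mx k ^+ N)) = 3^-1 * (K / (G0 * mx k ^+ N)).
      by rewrite invfM; ring.
    lra.
  rewrite /b /bump mulrC; apply: ler_pM => //; [by lra|exact: expR_ge0|].
  by apply: flat0_ge; apply: le_trans W1.
have bF0 k : 0 <= b k * F k by apply: mulr_ge0 => //; exact: ltW.
pose g x : R := \sum_(k <- s) b k * F k * \1_(expcube k) x.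
have mE k : measurable (expcube k) by exact: measurable_cube.
have gint : (\int[lam]_(x in D) (g x)%:E = \sum_(k <- s) (b k * F k * rad k ^+ n)%:E)%E.
  have mD := @measurable_punctured R n.
  under eq_integral do rewrite /g -sumEFin.
  rewrite ge0_integral_sum//; last 2 first.
  - move=> k; apply/measurable_EFinP; apply: measurable_funM; first exact: measurable_cst.
    exact: (measurable_indic (mE k)).
  - by move=> k x _; rewrite lee_fin; apply: mulr_ge0 => //.
  apply: eq_bigr => k _.
  rewrite (integralZl_indic mD (fun=> expcube k))//; last first.
    by rewrite ltNge bF0.
  rewrite integral_indic// setIidl; last exact: cube_punctured.
  by rewrite [X in (_ * X)%E](lebesgue_cube (rad0 k)) -EFinM.
have : (\int[lam]_(x in D) (g x)%:E <= \int[lam]_(x in D) (f x * phi x)%:E)%E.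
  have mD := @measurable_punctured R n.
  have phi0 x : 0 <= phi x by exact: barrier_test_ge0.
  apply: ae_ge0_le_integral => //.
  - by move=> x _; rewrite lee_fin sumr_ge0// => k _; apply: mulr_ge0.
  - apply/measurable_EFinP; apply: measurable_sum => k.
    apply: measurable_funM; first exact: measurable_cst.
    exact: (measurable_indic (mE k)).
  - by move=> x _; rewrite lee_fin mulr_ge0.
  - apply/measurable_EFinP; apply: measurable_funM => //.
    apply: measurable_funTS; apply: continuous_measurable_rV; first exact: openT.
    by move=> x _; exact: cphi.
  have : {ae lam, forall x, forall k, k \in s -> expcube k x -> F k <= f x}.
    elim: (s) HF => [_|k t IH Hk]; first exact: aeW.
    have h1 := Hk k (mem_head _ _).
    have h2 := IH (fun i it => Hk i (mem_behead (s := k :: t) it)).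
    apply: filterS2 h1 h2 => x H1 H2 i; rewrite inE => /orP[/eqP ->|]; first exact: H1.
    exact: H2.
  apply: filterS => x Hx Dx; rewrite lee_fin /g.
  have [[k ks Qx]|no] := pselect (exists2 k, k \in s & expcube k x).
    rewrite (bigD1_seq k)//= big1 ?addr0 => [|i ik]; last first.
      rewrite indicE memNset ?mulr0// => Qi.
      by move: ik; rewrite (expcube_disj Qi Qx) eqxx.
    rewrite indicE mem_set// mulr1 mulrC; apply: ler_pM => //; first exact: ltW.
      exact: Hx.
    exact: phi_ge.
  rewrite big_seq big1 ?mulr_ge0// => i is_; rewrite indicE memNset ?mulr0// => Qi.
  by apply: no; exists i.
move=> /le_trans /(_ H); rewrite gint sumEFin.
have iB := integrable_loc_subset measurable_punctured (@compact_shell R n 0 _ _) SD iu mB BS.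
have fB := integrable_fin_num mB iB.
rewrite -[X in (_ <= _ * X)%E -> _]fineK// -[X in _ -> (_ <= X)%E]fineK// -EFinM !lee_fin.
rewrite [leRHS]mulrAC ler_pdivlMr ?exprn_gt0// => h.
rewrite -(ler_pM2l (mulr_gt0 K0 Cb0)); apply: le_trans h.
rewrite le_eqVlt; apply/orP; left; apply/eqP.
rewrite /X /Sm mulrA [_ * (_ * \sum_(k <- s) _)]mulrA mulr_sumr [RHS]mulr_suml [LHS]mulr_suml.
apply: eq_bigr => k _; rewrite /c /b.
field.
by rewrite ?pnatr_eq0 ?expf_neq0 ?gt_eqF.
Qed.

(** The nonnegative integral of [f] against the test function is dropped, and the average over the
    second cube comes from the negative density of the subtracted power on it. The loss is that of
    the two extreme cases: none towards the origin, as for constants, and the decay of |x|^(2-n)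
    away from it. *)
Lemma harnack_cube : exists2 c : R, 0 < c & forall u f, nonneg_supersolution u f ->
  forall rho rho' M, 0 < rho -> 0 < rho' -> rho <= M -> rho' <= M ->
  {ae lam, forall x, cube rho x -> c * (rho' / M) ^+ N * average rho' u <= u x}.
Proof.
(* [expR (- 1)] bounds [bump1] from below where the barrier is at least 1; the rest is the density
   of the subtracted power, estimated by |x|^2 <= 4 n rho'^2 on the second cube. *)
pose k0 := expR (- 1) * r ^+ 2 * (4 * n%:R) `^ (- (r / 2) - 1).
have k0_gt0 : 0 < k0.
  by rewrite !mulr_gt0 ?expR_gt0 ?exprn_gt0 ?powR_gt0//; have := n3R; lra.
exists (k0 / (3 * G0 * Cb) / 2 ^+ n).
  apply: divr_gt0; last by rewrite exprn_gt0.
  by apply: divr_gt0 => //; apply: mulr_gt0 => //; apply: mulr_gt0.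
move=> u f [iu u0 mf f0 ge] rho rho' M rho0 rho0' rM rM'.
have M0 := lt_le_trans rho0 rM.
set c := _ / _; set X := c * 2 ^+ n * (rho' / M) ^+ N * average rho' u.
have -> : c * (rho' / M) ^+ N * average rho' u = X / 2 ^+ n.
  by rewrite /X; field; rewrite expf_neq0 ?pnatr_eq0// gt_eqF.
apply: cube_lower_bound => // y eps B Qy eprho mB BQ HB.
have /andP[e0 erho] := eprho.
pose K := 3 * G0 * M ^+ N.
have K0 : 0 < K by rewrite !mulr_gt0// exprn_gt0.
have a0 : 0 < pole K eps by rewrite /pole mulr_gt0// invr_gt0 exprn_gt0.
have c0 : 0 < (eps ^+ 2)^-1 by rewrite invr_gt0 exprn_gt0.
have d0 := low_gt0 rho0'.
pose kap := k0 / rho' ^+ 2.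
have kap0 : 0 < kap by rewrite divr_gt0// exprn_gt0.
pose m := Num.min rho rho'.
have m0 : 0 < m by rewrite lt_min rho0.
have mQ' := measurable_cube (n := n) rho0'.
have QS : cube rho' `<=` shell (m ^+ 2) (4 * n%:R * M ^+ 2).
  by apply: cube_shell => //; rewrite ge_min lexx orbT.
have BS : B `<=` shell (m ^+ 2) (4 * n%:R * M ^+ 2).
  by apply: (subset_trans BQ); apply: cube_shell => //; rewrite ge_min lexx.
have SD : shell (m ^+ 2) (4 * n%:R * M ^+ 2) `<=` D.
  by apply: shell_punctured; rewrite exprn_gt0.
have := @neg_laplacian_barrier R n r (pole K eps) (eps ^+ 2)^-1 (low rho') kap y u f B
  (cube rho') _ nr r0 a0 c0 d0 (ltW kap0) iu u0 ge (@compact_shell R n 0 _ _) SD mB mQ' BS QS HB.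
have iB := integrable_loc_subset measurable_punctured (@compact_shell R n 0 _ _) SD iu mB BS.
have iQ := integrable_loc_subset measurable_punctured (@compact_shell R n 0 _ _) SD iu mQ' QS.
have fB := integrable_fin_num mB iB; have fQ := integrable_fin_num mQ' iQ.
rewrite -[X in (_ * X - _)%E]fineK// -[X in (_ - _ * X)%E]fineK// -[leRHS]fineK//.
rewrite -!EFinM -EFinB pole_bound//.
move=> H; have {}H : 0 <= K * Cb / eps ^+ n * fine (\int[lam]_(x in B) (u x)%:E) -
    kap * fine (\int[lam]_(x in cube rho') (u x)%:E).
  rewrite -lee_fin; apply: le_trans (H _).
    by apply: integral_ge0 => x _; rewrite lee_fin mulr_ge0// barrier_test_ge0.
  move=> x Qx.
  have p3 : 3 <= pole K eps * cpow r ((eps ^+ 2)^-1 * sqdist y x).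
    apply: (le_trans _ (pole_ge K0 rho0 rho0' eprho rM rM' Qy Qx)).
    by rewrite /K -mulrA mulfK// mulf_neq0 ?expf_neq0// gt_eqF.
  have l1 := low_le1 rho0' (lexx _) Qx.
  have W1 : 1 <= barrier r (pole K eps) (eps ^+ 2)^-1 (low rho') y x.
    by rewrite /barrier; have := n3R; lra.
  have b1 : expR (- 1) <= bump1 (barrier r (pole K eps) (eps ^+ 2)^-1 (low rho') y x).
    apply: (le_trans (flat0_ge W1)); by rewrite /bump1 lerDl flat_ge0.
  have /andP[s1 s2] := cube_sqdist0 n0 rho0' Qx.
  have s0 : 0 < sqdist 0 x by apply: lt_le_trans s1; rewrite exprn_gt0.
  have -> : kap = expR (- 1) * (low rho' * (r ^+ 2 * (4 * n%:R * rho' ^+ 2) `^ (- (r / 2) - 1))).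
    rewrite powRM; [|have := n3R; lra|by rewrite exprn_ge0// ltW].
    have -> : (rho' ^+ 2) `^ (- (r / 2) - 1) = (low rho')^-1 / rho' ^+ 2.
      rewrite powRD; last by rewrite (gt_eqF (exprn_gt0 2 rho0')) implybT.
      by rewrite powRN powR_inv1// exprn_ge0// ltW.
    by rewrite /kap /k0; field; rewrite ?expf_neq0 ?gt_eqF.
  apply: ler_pM => //.
    by apply: mulr_ge0; [exact: ltW|apply: mulr_ge0; [exact: sqr_ge0|exact: powR_ge0]].
  rewrite ler_pM2l// ler_pM2l ?exprn_gt0//.
  rewrite -opprD; apply: powRN_anti => //.
  by rewrite addr_ge0// divr_ge0// ltW.
rewrite -[leRHS]fineK// lee_fin; move: H; rewrite subr_ge0 [leRHS]mulrAC ler_pdivlMr ?exprn_gt0// => H.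
rewrite -(ler_pM2l (mulr_gt0 K0 Cb0)); apply: le_trans H.
rewrite /X /c /average /kap /K le_eqVlt; apply/orP; left; apply/eqP.
rewrite exprMn exprVn [rho' ^+ n](_ : _ = rho' ^+ N * rho' ^+ 2); last first.
  by rewrite -exprD -n2.
field.
by rewrite ?pnatr_eq0 ?expf_neq0 ?gt_eqF.
Qed.

End superharmonic_bounds.

(** * Growth exponents of logarithmic averages *)

Section log_sequences.
Context {R : realType}.
Implicit Types (N A B P Q C D : R) (u v : int -> R).

(** For U_k = exp(u_k): up to the factor e^C, U_k is nonincreasing and U_k e^(Nk) is
    nondecreasing. *)
Definition log_harnack N C u := forall j k : int,
  u k + N * Num.min (k - j)%:~R 0 - C <= u j.

(** Finite sets of scales stand for the whole potential, which avoids any discussion of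
    convergence. *)
Definition log_green N A P C u v := forall (j : int) (s : seq int), uniq s ->
  \sum_(k <- s) expR (k%:~R * A + P * v k + N * Num.min (k - j)%:~R 0 - C)
    <= expR (u j).

Lemma log_green1 N A P C u v : log_green N A P C u v ->
  forall k : int, k%:~R * A + P * v k - C <= u k.
Proof.
move=> G k; have := G k [:: k] isT.
rewrite big_seq1 ler_expR subrr; by rewrite minxx mulr0 addr0.
Qed.

(** The contradiction behind all the exponent bounds: at least M terms of size e^(-D) against a
    bound e^(D') independent of M. The scale [j] may move with M. *)
Lemma log_green_bounded N A P C D D' u v : log_green N A P C u v ->
  (forall M : nat, exists (j : int) (s : seq int), [/\ uniq s, (M <= size s)%N,
    u j <= D' & forall k, k \in s ->
      - D <= k%:~R * A + P * v k + N * Num.min (k - j)%:~R 0 - C]) -> False.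
Proof.
move=> G H.
have [M hM] : exists M : nat, expR (D' + D) < M%:R.
  exists (Num.bound (expR (D' + D))); apply: archi_boundP; exact: expR_ge0.
have [j [s [us Ms uD hs]]] := H M.
have h1 : (size s)%:R * expR (- D) <= expR (u j).
  apply: le_trans (G j s us).
  have -> : (size s)%:R * expR (- D) = \sum_(k <- s) expR (- D).
    by rewrite big_const_seq count_predT iter_addr_0 mulr_natl.
  rewrite big_seq [leRHS]big_seq.
  by apply: ler_sum => k ks; rewrite ler_expR hs.
have h2 : (size s)%:R * expR (- D) <= expR D'.
  by apply: le_trans h1 _; rewrite ler_expR.
have : (size s)%:R <= expR (D' + D).
  rewrite expRD -[expR D]invrK -expRN ler_pdivlMr ?expR_gt0//.
have : M%:R <= (size s)%:R :> R by rewrite ler_nat.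
lra.
Qed.

Definition nonneg_ints (M : nat) : seq int := [seq Posz i | i <- iota 0 M].
Definition neg_ints (M : nat) : seq int := [seq - Posz i | i <- iota 1 M].

Lemma nonneg_intsP M : uniq (nonneg_ints M) /\ size (nonneg_ints M) = M.
Proof. by rewrite /nonneg_ints size_map size_iota map_inj_uniq ?iota_uniq// => i j []. Qed.

Lemma neg_intsP M : uniq (neg_ints M) /\ size (neg_ints M) = M.
Proof.
rewrite /neg_ints size_map size_iota map_inj_uniq ?iota_uniq//.
by move=> i j /oppr_inj[].
Qed.

Lemma mem_nonneg_ints M k : k \in nonneg_ints M -> 0 <= (k%:~R : R).
Proof. by case/mapP => i _ ->; rewrite ler0z. Qed.

Lemma mem_neg_ints M k : k \in neg_ints M -> - M%:R <= (k%:~R : R) <= 0.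
Proof.
case/mapP => i; rewrite mem_iota => /andP[i1 iM] ->.
by rewrite mulrNz oppr_le0 ler0z lerN2 -pmulrn ler_nat; lia.
Qed.

(** Suppose a >= 0. If P Q < 1, combining the one-term inequalities gives u_k >= k a - D, so seen
    from scale 0 all terms with k >= 0 are bounded below. If P Q > 1, the same combination gives u_k
    <= k a + D, hence a bound at scale -M, and the terms at -M, ..., -1 are bounded below because u
    is almost nonincreasing. *)
Lemma log_exponent_lt0 N A B P Q C u v a : 0 < N -> 0 < P -> 0 < Q ->
  log_harnack N C u -> log_green N A P C u v -> log_green N B Q C v u ->
  P * Q != 1 -> a * (1 - P * Q) = A + B * P -> a < 0.
Proof.
move=> N0 P0 Q0 H G1 G2 PQ1 ha; rewrite ltNge; apply/negP => a0.
have g1 := log_green1 G1; have g2 := log_green1 G2.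
have key k : k%:~R * (A + B * P) - C * (1 + P) <= u k * (1 - P * Q).
  have := ler_wpM2l (ltW P0) (g2 k); have := g1 k; lra.
move: PQ1; rewrite neq_lt => /orP[PQ1|PQ1].
- have d0 : 0 < 1 - P * Q by lra.
  set D := C * (1 + P) / (1 - P * Q).
  have lu k : k%:~R * a - D <= u k.
    rewrite -(ler_pM2r d0); apply: le_trans (key k).
    rewrite mulrBl -mulrA ha /D divfK ?gt_eqF//.
  apply: (@log_green_bounded _ _ _ _ (P * (Q * D + C) + C) (u 0) _ _ G1) => M.
  exists 0, (nonneg_ints M); have [-> ->] := nonneg_intsP M; split => //.
  move=> k /mem_nonneg_ints k0; rewrite subr0 min_r//.
  have h1 := ler_wpM2l (ltW P0) (g2 k).
  have h2 := ler_wpM2l (ltW P0) (ler_wpM2l (ltW Q0) (lu k)).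
  have h3 := mulr_ge0 k0 a0.
  have h4 : k%:~R * a = k%:~R * A + P * (k%:~R * B) + P * (Q * (k%:~R * a)).
    have -> : A = a * (1 - P * Q) - B * P by lra.
    ring.
  lra.
- have d0 : 0 < P * Q - 1 by lra.
  set D := C * (1 + P) / (P * Q - 1).
  have uu k : u k <= k%:~R * a + D.
    rewrite -(ler_pM2r d0) mulrDl /D divfK ?gt_eqF// -mulrA.
    have -> : a * (P * Q - 1) = - (A + B * P) by rewrite -ha; ring.
    have := key k; lra.
  apply: (@log_green_bounded _ _ _ _ (P * (Q * (C - u 0) + C) + C) D _ _ G1) => M.
  exists (- M%:Z), (neg_ints M); have [-> ->] := neg_intsP M; split => //.
    apply: le_trans (uu _) _; rewrite mulrNz; have : 0 <= M%:~R * a by rewrite mulr_ge0// ler0z.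
    lra.
  move=> k /mem_neg_ints/andP[k1 k0]; rewrite min_r; last first.
    by rewrite opprK intrD -pmulrn; lra.
  have h1 := ler_wpM2l (ltW P0) (g2 k).
  have u0 : u 0 - C <= u k.
    have := H k 0; rewrite min_r ?mulr0 ?addr0//.
    by rewrite sub0r mulrNz; lra.
  have h2 := ler_wpM2l (ltW P0) (ler_wpM2l (ltW Q0) u0).
  have h3 : 0 <= k%:~R * (A + B * P).
    rewrite -ha; apply: mulr_le0 => //; apply: mulr_ge0_le0 => //; lra.
  lra.
Qed.

(** The trace on logarithmic averages of the Kelvin transform |x|^(2-n) u(x / |x|^2). It sends an
    exponent al to - N - al, so negativity after the transform is the lower bound before it. *)
Definition log_kelvin N u (k : int) := u (- k) - N * k%:~R.

Lemma min_oppr0 (x : R) : Num.min (- x) 0 = Num.min x 0 - x.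
Proof. by case: (leP (- x) 0) => h1; case: (leP x 0) => h2; lra. Qed.

Lemma log_harnack_kelvin N C u : 0 < N -> log_harnack N C u -> log_harnack N C (log_kelvin N u).
Proof.
move=> N0 H j k; rewrite /log_kelvin; have := H (- j) (- k).
rewrite -(opprD k (- j)) (mulrNz _ (k - j)) min_oppr0 intrD !mulrNz; lra.
Qed.

Lemma log_green_kelvin N A P C u v : 0 < N -> log_green N A P C u v ->
  log_green N (P * N - N - A) P C (log_kelvin N u) (log_kelvin N v).
Proof.
move=> N0 H j s us; rewrite /log_kelvin.
have := H (- j) [seq - k | k <- s]; rewrite map_inj_uniq; last exact: oppr_inj.
move=> /(_ us); rewrite big_map.
rewrite expRD -ler_pdivrMr ?expR_gt0//; apply: le_trans.
rewrite mulr_suml; apply: ler_sum => k _.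
rewrite ler_pdivrMr ?expR_gt0// -expRD ler_expR.
rewrite -(opprD k (- j)) (mulrNz _ (k - j)) min_oppr0 intrD !mulrNz; lra.
Qed.

(* The exponents must solve [al = A + be P], [be = B + al Q]; for [P Q = 1] the
   two lines coincide and only have to cross the open square. *)
Lemma log_exponents N A B P Q C u v : 0 < N -> 0 < P -> 0 < Q ->
  log_harnack N C u -> log_harnack N C v ->
  log_green N A P C u v -> log_green N B Q C v u ->
  exists al be, [/\ - N < al < 0, - N < be < 0, al = A + be * P & be = B + al * Q].
Proof.
move=> N0 P0 Q0 Hu Hv G1 G2.
have Ku := log_harnack_kelvin N0 Hu; have Kv := log_harnack_kelvin N0 Hv.
have K1 := log_green_kelvin N0 G1; have K2 := log_green_kelvin N0 G2.
case: (eqVneq (P * Q) 1) => PQ1.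
- have g1 := log_green1 G1; have g2 := log_green1 G2.
  have key k : k%:~R * (A + B * P) <= C * (1 + P).
    have := ler_wpM2l (ltW P0) (g2 k); have := g1 k.
    have : P * (Q * u k) = u k by rewrite mulrA PQ1 mul1r.
    lra.
  (* A multiple of k that is bounded above over all integers k, of both signs, has coefficient 0. *)
  have AB : A + B * P = 0.
    apply/eqP; rewrite eq_le; apply/andP; split; rewrite leNgt; apply/negP => h.
    + have /(archi_boundP) : 0 <= `|C * (1 + P) / (A + B * P)| by [].
      set M := Num.bound _ => hM; have := key M%:Z.
      apply/negP; rewrite -ltNge -ltr_pdivrMr//.
      by apply: le_lt_trans hM; rewrite ler_norm.
    + have /(archi_boundP) : 0 <= `|C * (1 + P) / (A + B * P)| by [].
      set M := Num.bound _ => hM; have := key (- M%:Z).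
      apply/negP; rewrite -ltNge mulrNz -ltr_ndivlMr//.
      have := ler_norm (- (C * (1 + P) / (A + B * P))); rewrite normrN; lra.
  (* If A >= N P, the terms with k >= 0 seen from scale 0 do not decay, since v_k >= v_0 - N k - C.
     Likewise, if A <= - N, those with k < 0 do not, since there v_k >= v_0 - C. *)
  have AN : A < N * P.
    rewrite ltNge; apply/negP => h.
    apply: (@log_green_bounded _ _ _ _ (- (P * (v 0 - C) - C)) (u 0) _ _ G1) => M.
    exists 0, (nonneg_ints M); have [-> ->] := nonneg_intsP M; split => //.
    move=> k /mem_nonneg_ints k0; rewrite subr0 min_r//.
    have := Hv k 0; rewrite sub0r mulrNz min_l ?oppr_le0// => h1.
    have := ler_wpM2l (ltW P0) h1; have := ler_wpM2l k0 h.
    lra.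
  have AN' : - N < A.
    rewrite ltNge; apply/negP => h.
    apply: (@log_green_bounded _ _ _ _ (- (P * (v 0 - C) - C)) (u 0) _ _ G1) => M.
    exists 0, (neg_ints M); have [-> ->] := neg_intsP M; split => //.
    move=> k /mem_neg_ints/andP[_ k0]; rewrite subr0 min_l//.
    have := Hv k 0; rewrite sub0r mulrNz min_r ?oppr_ge0// => h1.
    have := ler_wpM2l (ltW P0) h1; have := ler_wnM2l k0 h.
    lra.
  (* [l] and [h] delimit the values of [be] for which [be] and [A + be * P] both lie in ]-N, 0[; the
     two bounds on [A] make this interval nonempty. *)
  set l := Num.max (- N) ((- N - A) / P); set h := Num.min 0 (- A / P).
  have lh : l < h.
    rewrite /l /h gt_max !lt_min.
    rewrite oppr_lt0 N0 ltr_pdivlMr// ltr_pdivrMr// mul0r ltr_pM2r ?invr_gt0//.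
    by apply/and3P; split => //; lra.
  pose be := (l + h) / 2.
  have [lb bh] : l < be /\ be < h by rewrite /be; split; lra.
  clearbody be.
  exists (A + be * P), be; split => //.
  + move: lb bh; rewrite /l /h gt_max lt_min ltr_pdivrMr// ltr_pdivlMr//.
    by move=> /andP[_ ?] /andP[_ ?]; apply/andP; split; lra.
  + by move: lb bh; rewrite /l /h gt_max lt_min => /andP[-> _] /andP[-> _].
  + rewrite mulrDl -mulrA PQ1 mulr1.
    have : Q * (A + B * P) = 0 by rewrite AB mulr0.
    have : Q * (B * P) = B by rewrite mulrCA [Q * P]mulrC PQ1 mulr1.
    lra.
- have d0 : 1 - P * Q != 0 by rewrite subr_eq0 eq_sym.
  have QP1 : Q * P != 1 by rewrite mulrC.
  pose al := (A + B * P) / (1 - P * Q); pose be := (B + A * Q) / (1 - P * Q).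
  have hal : al * (1 - P * Q) = A + B * P by rewrite /al divfK.
  have hbe' : be * (1 - P * Q) = B + A * Q by rewrite /be divfK.
  have hbe : be * (1 - Q * P) = B + A * Q by rewrite [Q * P]mulrC.
  exists al, be; split.
  + apply/andP; split; last exact: (log_exponent_lt0 N0 P0 Q0 Hu G1 G2 PQ1 hal).
    have : - N - al < 0.
      apply: (log_exponent_lt0 N0 P0 Q0 Ku K1 K2 PQ1).
      by rewrite mulrBl hal; ring.
    lra.
  + apply/andP; split; last exact: (log_exponent_lt0 N0 Q0 P0 Hv G2 G1 QP1 hbe).
    have : - N - be < 0.
      apply: (log_exponent_lt0 N0 Q0 P0 Kv K2 K1 QP1).
      by rewrite mulrBl hbe; ring.
    lra.
  + by apply: (mulIf d0); rewrite hal mulrDl (mulrAC be) hbe'; ring.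
  + by apply: (mulIf d0); rewrite hbe' mulrDl (mulrAC al) hal; ring.
Qed.

End log_sequences.

(** * From averages to logarithmic sequences *)

Section log_averages.
Context {R : realType} {n : nat}.
Hypothesis n3 : (3 <= n)%N.
Implicit Types (u v f : 'rV[R]_n -> R).
Local Notation lam := (lebesgue_rV R n).
Local Notation N := ((n - 2)%N%:R : R).

Let n0 : (0 < n)%N. Proof. exact: leq_trans n3. Qed.

Definition log_average u (k : int) : R := ln (average (expR k%:~R) u).

Lemma average_gt0 u (rho : R) : 0 < rho -> loc_integrable (@punctured R n) u ->
  {ae lam, forall x, punctured x -> 0 < u x} -> 0 < average rho u.
Proof.
move=> rho0 iu pu; rewrite /average divr_gt0 ?exprn_gt0//.
have mQ := measurable_cube (n := n) rho0; have iQ := integrable_cube n0 rho0 iu.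
have QD := cube_punctured n0 rho0.
have mu : measurable_fun (cube rho) (EFin \o u) by exact: measurable_int iQ.
have eq : (\int[lam]_(x in cube rho) (u x)%:E = \int[lam]_(x in cube rho) `|(u x)%:E|)%E.
  apply: ae_eq_integral => //; first exact: measurableT_comp.
  by apply: filterS pu => x h Qx /=; rewrite ger0_norm// ltW// h//; exact: QD.
have I0 : (0 <= \int[lam]_(x in cube rho) (u x)%:E)%E.
  by rewrite eq; apply: integral_ge0.
rewrite lt_neqAle fine_ge0// andbT eq_sym; apply/negP => /eqP I00.
have {}I00 : (\int[lam]_(x in cube rho) `|(EFin \o u) x| = 0)%E.
  by rewrite -eq -[LHS]fineK ?I00//; exact: integrable_fin_num.
have /(ae_eq_integral_abs lam mQ mu) z := I00.
have : {ae lam, forall x, ~ cube rho x}.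
  apply: filterS2 z pu => x /= h1 h2 Qx; have := h1 Qx => -[u0].
  by have := h2 (QD _ Qx); rewrite u0 ltxx.
move=> [A [mA A0 QA]]; have : (lam (cube rho) <= lam A)%E.
  apply: le_measure; rewrite ?inE// => x Qx; apply: QA => /=; exact.
by rewrite [X in (_ <= X)%E]A0 [X in (X <= _)%E](lebesgue_cube rho0) lee_fin leNgt exprn_gt0.
Qed.

Lemma maxE (s t : R) : Num.max s t = t - Num.min (t - s) 0.
Proof. by case: (leP s t) => h; case: (leP (t - s) 0) => h'; lra. Qed.

Lemma max_expR (s t : R) : Num.max (expR s) (expR t) = expR (Num.max s t).
Proof.
by rewrite /Num.max ltr_expR; case: ifP.
Qed.

Lemma expR_ratio (j k : int) :
  (expR k%:~R / Num.max (expR j%:~R) (expR k%:~R)) ^+ (n - 2) =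
  expR (N * Num.min (k - j)%:~R 0) :> R.
Proof.
rewrite max_expR maxE -expRN -expRD expRM_natl; congr (expR _ ^+ _).
by rewrite intrB; ring.
Qed.

Lemma log_harnack_average : exists C, forall u f, nonneg_supersolution u f ->
  (forall k, 0 < average (expR k%:~R) u) -> log_harnack N C (log_average u).
Proof.
have [c c0 H] := @harnack_cube R n n3; exists (- ln c) => u f sf pos j k.
have e0 (i : int) := expR_gt0 (i%:~R : R).
rewrite /log_average opprK.
have := H u f sf _ _ (Num.max (expR j%:~R) (expR k%:~R)) (e0 j) (e0 k).
rewrite !le_max !lexx orbT => /(_ isT isT) h.
have [iu _ _ _ _] := sf.
have := average_ge n0 (e0 j) iu h; rewrite expR_ratio => {}h.
rewrite -ler_expR !expRD !lnK ?posrE//.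
by apply: le_trans h; rewrite le_eqVlt; apply/orP; left; apply/eqP; ring.
Qed.

(** The exponent a + 2 collects |x|^a on the k-th cube and the quotient of its volume e^(kn) by the
    e^(k(n-2)) that normalises the Green kernel. *)
Lemma log_green_average (l a p : R) : 0 < l -> exists C, forall u v g,
  nonneg_supersolution u (fun x => l * enorm x `^ a * v x `^ p) ->
  nonneg_supersolution v g -> 0 < p ->
  (forall k, 0 < average (expR k%:~R) u) -> (forall k, 0 < average (expR k%:~R) v) ->
  log_green N (a + 2) p C (log_average u) (log_average v).
Proof.
move=> l0; have [c c0 H] := @harnack_cube R n n3; have [c' c'0 G] := @green_cube R n n3.
have n0R : 0 < n%:R :> R by rewrite ltr0n.
(* On the k-th cube |x|^2 lies between e^(2k) and 4 n e^(2k); the minimum serves both signs of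
   [a]. *)
pose c5 : R := Num.min 1 ((4 * n%:R) `^ (a / 2)).
have c50 : 0 < c5 by rewrite lt_min ltr01 powR_gt0// mulr_gt0.
exists (- ln (c' * (l * c5 * c `^ p))) => u v g su sv p0 posu posv j s us.
have e0 (i : int) := expR_gt0 (i%:~R : R).
pose F k := l * (c5 * expR (k%:~R * a)) * (c * average (expR k%:~R) v) `^ p.
have F0 k : 0 <= F k.
  by rewrite /F !mulr_ge0 ?powR_ge0 ?expR_ge0 ?ltW.
have FH k : k \in s -> {ae lam, forall x : 'rV[R]_n, expcube k x ->
    F k <= l * enorm x `^ a * v x `^ p}.
  move=> _; have := H v g sv _ _ _ (e0 k) (e0 k) (lexx _) (lexx _).
  apply: filterS => x Hx Qx; have := Hx Qx; rewrite divff ?gt_eqF// expr1n mulr1 => h.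
  have h0 : 0 <= c * average (expR k%:~R) v by rewrite mulr_ge0 ?ltW.
  apply: ler_pM; rewrite ?powR_ge0//.
  - by rewrite !mulr_ge0 ?expR_ge0 ?ltW.
  - rewrite ler_pM2l// enorm_powR.
    have /andP[s1 s2] := cube_sqdist0 n0 (e0 k) Qx.
    have -> : expR (k%:~R * a) = ((expR k%:~R : R) ^+ 2) `^ (a / 2).
      by rewrite -expRM_natl -expRM; congr expR; field.
    set t := _ ^+ 2 in s1 s2 *; have t0 : 0 < t by rewrite exprn_gt0.
    have [a0|a0] := leP 0 (a / 2).
      apply: (@le_trans _ _ (1 * t `^ (a / 2))).
        by rewrite ler_wpM2r ?powR_ge0// ge_min lexx.
      rewrite mul1r; apply: ge0_ler_powR => //; rewrite nnegrE ?(ltW t0)//.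
      exact: sqdist_ge0.
    apply: (@le_trans _ _ ((4 * n%:R) `^ (a / 2) * t `^ (a / 2))).
      by rewrite ler_wpM2r ?powR_ge0// ge_min lexx orbT.
    rewrite -powRM ?mulr_ge0 ?(ltW t0)// -[a / 2]opprK; apply: powRN_anti => //.
      by rewrite oppr_ge0 ltW.
    exact: lt_le_trans s1.
  - have [_ v0 _ _ _] := sv.
    by apply: ge0_ler_powR; rewrite ?nnegrE ?(ltW p0).
have [iu _ _ _ _] := su.
have := average_ge n0 (e0 j) iu (G u _ su j s F us F0 FH).
rewrite {2}/log_average lnK ?posrE//; apply: le_trans.
rewrite mulr_sumr; apply: ler_sum => k _.
rewrite expRD opprK lnK ?posrE ?mulr_gt0 ?powR_gt0//.
rewrite le_eqVlt; apply/orP; left; apply/eqP.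
rewrite /F powRM ?ltW//.
have -> : average (expR k%:~R) v `^ p = expR (p * log_average v k).
  by rewrite /log_average -[in LHS](@lnK _ (average (expR k%:~R) v)) ?posrE// -expRM mulrC.
have -> : expR k%:~R ^+ n = expR k%:~R ^+ (n - 2) * expR (k%:~R * 2) :> R.
  have -> : expR (k%:~R * 2) = expR k%:~R ^+ 2 :> R by rewrite mulrC expRM_natl.
  by rewrite -exprD subnK// ltnW.
have := expR_ratio j k; rewrite expr_div_n => hr.
rewrite !expRD -hr mulrDr expRD; field.
by rewrite expf_neq0// gt_eqF// lt_max e0.
Qed.

End log_averages.

(** * Integration by parts and power functions *)

Section integration.
Context {R : realType}.

Definition box (n : nat) (L : R) : set 'rV[R]_n := [set x | forall j, `|x ord0 j| <= L].
Arguments box : clear implicits.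

Lemma compact_box n L : compact (box n L).
Proof.
rewrite (_ : box n L = [set v : 'rV[R]_n | forall i, `[- L, L]%classic (v ord0 i)]).
  by apply: (@rV_compact _ _ (fun=> `[- L, L]%classic)) => i; exact: segment_compact.
by apply/seteqP; split => x h i; have := h i; rewrite /= in_itv /= ler_norml.
Qed.

Lemma compact_finite_rV n (K : set 'rV[R]_n) : compact K -> (lebesgue_rV R n K < +oo)%E.
Proof.
move=> cK; have [M [Mr HM]] := compact_bounded cK.
pose L := `|M| + 1; have KL : K `<=` box n L.
  move=> x Kx j; apply: le_trans (HM L _ x Kx); last first.
    by rewrite /L; have := ler_norm M; lra.
  rewrite [leRHS]mx_normrE; apply: (le_trans _ (@le_bigmax _ _ _ 0 _ (ord0, j))).
  exact: lexx.
have mL : measurable (box n L) by apply: compact_measurable_rV; exact: compact_box.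
apply: (@le_lt_trans _ _ (lebesgue_rV R n (box n L))).
  by apply: le_measure; rewrite ?inE//; exact: compact_measurable_rV.
rewrite (_ : box n L = [set v : 'rV[R]_n | forall i, `[- L, L]%classic (v ord0 i)]).
  rewrite (@lebesgue_rV_box R n (fun=> `[- L, L]%classic))//.
  have L0 : - L < L by rewrite /L; have := normr_ge0 M; lra.
  under eq_bigr do rewrite lebesgue_measure_itv /= lte_fin L0 -EFinB.
  by rewrite prodEFin ltry.
by apply/seteqP; split => x h i; have := h i; rewrite /= in_itv /= ler_norml.
Qed.

Lemma loc_integrable_continuous n (D : set 'rV[R]_n) (f : 'rV[R]_n -> R) : open D ->
  (forall x, D x -> {for x, continuous f}) -> loc_integrable D f.
Proof.
move=> oD cf; have mf := continuous_measurable_rV oD cf; split=> // K KD cK.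
have mK := compact_measurable_rV cK.
have [M [Mr HM]] : bounded_set (f @` K).
  apply: compact_bounded; apply: continuous_compact => //.
  apply: continuous_in_subspaceT => x /set_mem Kx; exact: cf (KD _ Kx).
have ic : (lebesgue_rV R n).-integrable K (EFin \o (fun=> `|M| + 1)).
  apply/integrableP; split; first exact: measurable_cst.
  rewrite integral_cst//= lte_mul_pinfty ?lee_fin//.
  exact: compact_finite_rV.
apply: (le_integrable mK _ _ ic).
  by apply/measurable_EFinP; exact: measurable_funS (open_measurable_rV oD) KD mf.
move=> x Kx /=; rewrite lee_fin [leRHS]ger0_norm//.
by apply: HM; [have := ler_norm M; lra|exists x].
Qed.

Lemma integrable_continuous_compact n (S : set 'rV[R]_n) (g : 'rV[R]_n -> R) :
  compact S -> continuous g -> (forall x, ~ S x -> g x = 0) ->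
  (lebesgue_rV R n).-integrable setT (EFin \o g).
Proof.
move=> cS cg g0.
have i1 : loc_integrable [set: 'rV[R]_n] (fun=> 1 : R).
  by apply: loc_integrable_continuous => [|x _]; [exact: openT|exact: cst_continuous].
have := integrable_mul_compact measurableT cS (@subsetT _ _) i1 cg g0.
by apply: eq_integrable => // x _; rewrite mul1r.
Qed.

Lemma integral_derive_compact (H H' : R -> R) (L : R) : continuous H' ->
  (forall t : R, is_derive t 1 H (H' t)) -> (forall t, L < `|t| -> H t = 0) ->
  (\int[lebesgue_measure]_t (H' t)%:E = 0)%E.
Proof.
move=> cH' dH H0; pose b := `|L| + 1.
have b0 : 0 < b by rewrite /b; have := normr_ge0 L; lra.
have Lb (t : R) : b <= `|t| -> L < `|t| by rewrite /b; have := ler_norm L; lra.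
have H'0 (t : R) : b < `|t| -> H' t = 0.
  move=> bt; have [_ <-] := dH t; rewrite -[RHS](derive_cst (0 : R) t (1 : R)).
  apply: near_eq_derive; near=> s; apply: H0; apply: Lb; apply: ltW.
  near: s; apply: (@open_nbhs_nbhs _ t [set s | b < `|s|]); split => //.
  apply: (@open_comp _ _ (fun s : R => `|s|) [set s | b < s]); last exact: open_gt.
  by move=> s _; exact: norm_continuous.
have -> : (\int[lebesgue_measure]_t (H' t)%:E = \int[lebesgue_measure]_(t in `[(- b)%R, b]) (H' t)%:E)%E.
  rewrite [RHS]integral_mkcond; apply: eq_integral => t _; rewrite patchE.
  case: ifPn => // /negP tb; rewrite H'0// ltNge; apply/negP => h; apply: tb.
  by apply: mem_set; rewrite /= in_itv /= -ler_norml.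
have cH (t : R) : {for t, continuous H} by exact: is_derive1_continuous (dH t).
rewrite (@continuous_FTC2 _ H' H).
- by rewrite !H0 ?subee//; apply: Lb; rewrite ?normrN ger0_norm// ltW.
- lra.
- exact: continuous_subspaceT.
- split.
  + by move=> t _; have [h _] := dH t.
  + exact: cvg_at_right_filter (cH _).
  + exact: cvg_at_left_filter (cH _).
- by move=> t _; rewrite derive1E; have [_ ->] := dH t.
Unshelve. all: by end_near. Qed.

Lemma cons_rV_continuousl n (y : 'rV[R]_n) : continuous (fun t : R => cons_rV (t, y)).
Proof.
move=> t; apply/cvg_ballP => e e0.
apply: filterS (@nbhsx_ballx _ R t e e0) => s ts; split => // i j.
by rewrite ord1 !mxE /=; case: unliftP => [k _|_] //=; exact: ballxx.
Qed.

Lemma cons_rV_continuousr n (t : R) : continuous (fun y : 'rV[R]_n => cons_rV (t, y)).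
Proof.
move=> y A /nbhs_ballP[e /= e0 eA]; apply/nbhs_ballP; exists e => // z [_ yz].
apply: eA; split => // i j.
by rewrite ord1 !mxE /=; case: unliftP => [k _|_] //=; exact: ballxx.
Qed.

Lemma cons_rV_shiftl n (t h : R) (y : 'rV[R]_n) :
  h *: delta_mx ord0 ord0 + cons_rV (t, y) = cons_rV (h + t, y).
Proof.
apply/rowP => i; rewrite !mxE /=; case: unliftP => [k ->|->] /=.
  by rewrite [h * _]mulr0 add0r.
by rewrite [h * _]mulr1.
Qed.

Lemma cons_rV_shiftr n (t h : R) (j : 'I_n) (y : 'rV[R]_n) :
  h *: delta_mx ord0 (lift ord0 j) + cons_rV (t, y) = cons_rV (t, h *: delta_mx ord0 j + y).
Proof.
apply/rowP => i; rewrite !mxE /=; case: unliftP => [k ->|->] /=.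
  by rewrite !mxE ?eqxx /= (inj_eq lift_inj).
by rewrite [h * _]mulr0 add0r.
Qed.

(** Induction on the dimension through [cons_rV]. A derivative in the first coordinate is integrated
    first in that variable, by the fundamental theorem of calculus; any other one is, for a fixed
    first coordinate, a partial derivative in one dimension less. *)
Lemma integral_partial_eq0 n (i : 'I_n) (F : 'rV[R]_n -> R) (L : R) :
  (forall x, derivable F x (delta_mx ord0 i)) -> continuous (partial i F) ->
  (forall x, ~ box n L x -> F x = 0) ->
  (\int[lebesgue_rV R n]_x (partial i F x)%:E = 0)%E.
Proof.
elim: n i F => [[]//|n IH] i F dF cF F0.
have iG : (lebesgue_rV R n.+1).-integrable setT (EFin \o partial i F).
  apply: (integrable_continuous_compact (@compact_box _ L)) => //.
  apply: partial_eq0 => //; apply: compact_closed; first exact: norm_hausdorff.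
  exact: compact_box.
have mG : measurable_fun setT (EFin \o partial i F) by exact: measurable_int iG.
have iG' : (lebesgue_measure \x lebesgue_rV R n)%E.-integrable setT
    ((EFin \o partial i F) \o cons_rV).
  apply/integrableP; split.
    by apply: measurableT_comp => //; exact: measurable_cons_rV.
  have /integrableP[_] := iG; apply: le_lt_trans.
  rewrite le_eqVlt; apply/orP; left; apply/eqP.
  have -> : [set: measurableTypeR R * 'rV[R]_n] = cons_rV @^-1` setT by [].
  rewrite -(@ge0_integral_pushforward _ _ _ _ _ _ (@measurable_cons_rV R n) _ _
    (fun x => `|(EFin \o partial i F) x|)%E)//.
  exact: measurableT_comp.
have dval x : is_derive x (delta_mx ord0 i) F (partial i F x).
  by apply: DeriveDef => //; exact: dF.
have -> : (\int[lebesgue_rV R n.+1]_x (partial i F x)%:E =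
    \int[lebesgue_measure \x lebesgue_rV R n]_z (partial i F (cons_rV z))%:E)%E.
  exact: (integral_pushforward (@measurable_cons_rV R n) mG iG' measurableT).
case: (unliftP ord0 i) => [j|] ei.
- rewrite -(integral12_prod_meas1 iG') /=.
  rewrite (eq_integral (fun=> 0%E)) ?integral0// => t _; rewrite /fubini_F /=.
  have pE y : partial i F (cons_rV (t, y)) = partial j (fun y => F (cons_rV (t, y))) y.
    have /is_derive_line h := dval (cons_rV (t, y)).
    rewrite /partial; apply/esym.
    have [] : is_derive y (delta_mx ord0 j) (fun y => F (cons_rV (t, y)))
      (partial i F (cons_rV (t, y))); last by move=> _ ->.
    apply/is_derive_line; move: h; congr is_derive; apply/funext => s.
    by rewrite ei cons_rV_shiftr.
  under eq_integral do rewrite pE.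
  apply: IH.
  + move=> y; have /is_derive_line h := dval (cons_rV (t, y)).
    suff [] : is_derive y (delta_mx ord0 j) (fun y => F (cons_rV (t, y)))
      (partial i F (cons_rV (t, y))) by [].
    apply/is_derive_line; move: h; congr is_derive; apply/funext => s.
    by rewrite ei cons_rV_shiftr.
  + rewrite (_ : partial j _ = (fun y => partial i F (cons_rV (t, y)))); last first.
      by apply/funext => y; rewrite pE.
    move=> y; apply: (@continuous_comp _ _ _ (fun y : 'rV[R]_n => cons_rV (t, y))).
      exact: cons_rV_continuousr.
    exact: cF.
  + move=> y ny; apply: F0 => h; apply: ny => k; have := h (lift ord0 k).
    by rewrite mxE liftK.
- rewrite -(integral21_prod_meas1 iG') /=.
  rewrite (eq_integral (fun=> 0%E)) ?integral0// => y _; rewrite /fubini_G /=.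
  apply: (@integral_derive_compact (fun t => F (cons_rV (t, y))) _ L).
  + move=> t; apply: (@continuous_comp _ _ _ (fun t : R => cons_rV (t, y))).
      exact: cons_rV_continuousl.
    exact: cF.
  + move=> t; have /is_derive_line h := dval (cons_rV (t, y)).
    apply/is_derive_line; move: h; congr is_derive; apply/funext => s.
    by rewrite ei cons_rV_shiftl /GRing.scale /= mulr1.
  + move=> t Lt; apply: F0 => /(_ ord0); rewrite mxE unlift_none /= => h.
    by move: Lt; rewrite ltNge h.
Qed.

End integration.

(** * The distributional Laplacian of powers of |x| *)

Section power_functions.
Context {R : realType} {n : nat}.
Local Notation lam := (lebesgue_rV R n).
Local Notation D := (@punctured R n).
Local Notation e := (delta_mx ord0).

Lemma continuous_sqdist_powR (r : R) (x : 'rV[R]_n) : D x ->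
  {for x, continuous (fun z => sqdist 0 z `^ r)}.
Proof.
move=> Dx; have h : smooth_expr D (fun z => sqdist 0 z `^ r).
  by apply: SmoothPow => [|z]; [exact: smooth_expr_sqdist|exact: sqdist0_gt0].
exact: smooth_expr_continuous h x Dx.
Qed.

Lemma loc_integrable_sqdist_powR (c r : R) : loc_integrable D (fun z => c * sqdist 0 z `^ r).
Proof.
apply: loc_integrable_continuous; first exact: open_punctured.
move=> x Dx; apply: continuousM; first exact: cst_continuous.
exact: continuous_sqdist_powR.
Qed.

Lemma continuous_zero_ext (S : set 'rV[R]_n) (g : 'rV[R]_n -> R) :
  closed S -> S `<=` D -> (forall x, D x -> {for x, continuous g}) ->
  (forall x, ~ S x -> g x = 0) -> continuous g.
Proof.
move=> cS SD cg g0 x; have [Dx|nDx] := pselect (D x); first exact: cg.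
have nSx : ~ S x by move=> /SD.
have h : {near x, (cst 0 : _ -> R) =1 g}.
  near=> y; rewrite g0//; near: y.
  by apply: (@open_nbhs_nbhs _ x (~` S)); split => //; exact: closed_openC.
change (g @ x --> g x); rewrite g0//.
apply: cvg_trans (near_eq_cvg h) _; exact: cvg_cst.
Unshelve. all: by end_near. Qed.

(** Green's second identity for the power A = |x|^(2r): the field A grad phi - phi grad A has
    compact support off the origin, so its divergence A Delta phi - phi Delta A has integral 0, and
    Delta A = 2r (2r - 2 + n) |x|^(2r-2). *)
Lemma power_neg_laplacian (r : R) (phi : 'rV[R]_n -> R) : test_function D phi ->
  (\int[lam]_(x in D) (sqdist 0 x `^ r * - laplacian phi x)%:E =
   \int[lam]_(x in D) ((- (2 * r * (2 * r - 2 + n%:R))) * sqdist 0 x `^ (r - 1) * phi x)%:E)%E.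
Proof.
move=> tf; have [sphi cS SD] := tf.
set S := closure _ in cS SD.
have clS : closed S by exact: closed_closure.
have p0 x : ~ S x -> phi x = 0.
  move=> nx; apply/eqP; apply: contrapT => /negP px; apply: nx.
  exact: subset_closure.
have p1 i x : ~ S x -> partial i phi x = 0 by exact: (@partial_eq0 _ _ i phi S clS p0 x).
have p2 i x : ~ S x -> partial i (partial i phi) x = 0.
  exact: (@partial_eq0 _ _ i (partial i phi) S clS (p1 i) x).
have cp : continuous phi by have [] := sphi [::].
have cp1 i : continuous (partial i phi) by have [] := sphi [:: i].
have cp2 i : continuous (partial i (partial i phi)) by have [] := sphi [:: i; i].
have dp x i : is_derive x (e i) phi (partial i phi x).
  by apply: DeriveDef => //; have [_ h] := sphi [::]; exact: h.
have dp1 x i : is_derive x (e i) (partial i phi) (partial i (partial i phi) x).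
  by apply: DeriveDef => //; have [_ h] := sphi [:: i]; exact: h.
pose A s := s `^ r; pose A1 s := r * s `^ (r - 1).
pose A2 s := r * (r - 1) * s `^ (r - 1 - 1).
pose w1 i (z : 'rV[R]_n) := A1 (sqdist 0 z) * (2 * (z ord0 i - (0 : 'rV[R]_n) ord0 i)).
pose w2 i (z : 'rV[R]_n) :=
  A2 (sqdist 0 z) * (2 * (z ord0 i - (0 : 'rV[R]_n) ord0 i)) ^+ 2 + 2 * A1 (sqdist 0 z).
have dw i x : D x -> is_derive x (e i) (fun z => A (sqdist 0 z)) (w1 i x).
  move=> Dx; apply: (@is_derive_radial _ _ 0 A A1).
  exact: is_derive1_powR (sqdist0_gt0 Dx).
have dw1 i x : D x -> is_derive x (e i) (w1 i) (w2 i x).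
  move=> Dx; apply: is_derive_radial2.
  apply: (is_derive_val (is_derive_scale r (is_derive1_powR (r - 1) (sqdist0_gt0 Dx)))).
  by rewrite /A2 mulrA.
pose F i z := A (sqdist 0 z) * partial i phi z - phi z * w1 i z.
pose G i z := A (sqdist 0 z) * partial i (partial i phi) z - phi z * w2 i z.
have dF i x : is_derive x (e i) (F i) (G i x).
  have [Dx|nDx] := pselect (D x).
    apply: (is_derive_val (is_derive_sub (is_derive_mul (dw i x Dx) (dp1 x i))
      (is_derive_mul (dp x i) (dw1 i x Dx)))).
    by rewrite /G /w1; ring.
  (* At the origin the power is not differentiable in general, but phi vanishes nearby, so [F i] is
     locally 0. *)
  have nSx : ~ S x by move=> /SD.
  have -> : G i x = 0 by rewrite /G p0// p2// mulr0 mul0r subr0.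
  apply: (@near_eq_is_derive _ _ _ (fun=> 0 : R)).
  near=> z; have nSz : ~ S z.
    near: z; apply: (@open_nbhs_nbhs _ x (~` S)); split => //; exact: closed_openC.
  by rewrite /F p0// p1// mulr0 mul0r subr0.
have G0 i x : ~ S x -> G i x = 0 by move=> nS; rewrite /G p0// p2// mulr0 mul0r subr0.
have cG i : continuous (G i).
  apply: (continuous_zero_ext clS SD _ (G0 i)) => x Dx.
  have ca (s : R) := @continuous_sqdist_powR s x Dx.
  have cl : {for x, continuous (fun z : 'rV[R]_n => 2 * (z ord0 i - (0 : 'rV[R]_n) ord0 i))}.
    apply: continuousM; first exact: cst_continuous.
    by apply: continuousB; [exact: coord_continuous|exact: cst_continuous].
  apply: continuousB; apply: continuousM.
  - exact: ca.
  - exact: cp2.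
  - exact: cp.
  apply: continuousD.
    apply: continuousM.
      by apply: continuousM; [exact: cst_continuous|exact: ca].
    by rewrite (_ : (fun _ => _) = (fun z : 'rV[R]_n =>
      (2 * (z ord0 i - (0 : 'rV[R]_n) ord0 i)) * (2 * (z ord0 i - (0 : 'rV[R]_n) ord0 i))));
      [exact: continuousM|apply/funext => z; rewrite expr2].
  apply: continuousM; first exact: cst_continuous.
  by apply: continuousM; [exact: cst_continuous|exact: ca].
have [L HL] : exists L, S `<=` @box R n L.
  have [M [Mr HM]] := compact_bounded cS.
  exists (`|M| + 1); move=> z Sz j; apply: le_trans (HM (`|M| + 1) _ z Sz); last first.
    by have := ler_norm M; lra.
  rewrite [leRHS]mx_normrE; apply: (le_trans _ (@le_bigmax _ _ _ 0 _ (ord0, j))).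
  exact: lexx.
have F0 i x : ~ @box R n L x -> F i x = 0.
  move=> nb; have nS : ~ S x by move=> /HL.
  by rewrite /F p0// p1// mulr0 mul0r subr0.
have pF i : partial i (F i) = G i.
  by apply/funext => x; rewrite /partial; have [_ ->] := dF i x.
have IG i : (\int[lam]_x (G i x)%:E = 0)%E.
  under eq_integral do rewrite -pF.
  apply: (@integral_partial_eq0 _ _ _ _ L); [|by rewrite pF|exact: F0].
  by move=> x; have [] := dF i x.
have iG i : lam.-integrable setT (EFin \o G i).
  exact: integrable_continuous_compact cS (cG i) (G0 i).
pose c := - (2 * r * (2 * r - 2 + n%:R)).
have sumG x : D x -> \sum_i G i x = c * sqdist 0 x `^ (r - 1) * phi x -
    sqdist 0 x `^ r * - laplacian phi x.
  move=> Dx; rewrite /G sumrB -mulr_sumr -mulr_sumr /w2 sum_radial2.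
  rewrite -/(laplacian phi x) /A /A1 /A2 -(@powRS _ (sqdist 0 x) (r - 1)) ?sqdist0_gt0//.
  by rewrite /c; ring.
have mD := @measurable_punctured R n.
have i1 : lam.-integrable D (fun x => (sqdist 0 x `^ r * - laplacian phi x)%:E).
  apply: (integrable_mul_compact mD cS SD).
  - have := loc_integrable_sqdist_powR 1 r.
    by congr loc_integrable; apply/funext => x; rewrite mul1r.
  - by move=> x; apply: continuousN; exact: smooth_laplacian_continuous.
  - by move=> x nS; rewrite /laplacian big1 ?oppr0// => i _; exact: p2.
have i2 : lam.-integrable D (fun x => (c * sqdist 0 x `^ (r - 1) * phi x)%:E).
  apply: (integrable_mul_compact mD cS SD _ cp p0).
  exact: loc_integrable_sqdist_powR.
have : (\int[lam]_(x in D) (c * sqdist 0 x `^ (r - 1) * phi x)%:E -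
    \int[lam]_(x in D) (sqdist 0 x `^ r * - laplacian phi x)%:E = 0)%E.
  rewrite -integralB_EFin//.
  transitivity (\int[lam]_x (\sum_i (G i x)%:E))%E; last first.
    by rewrite integral_sum// big1.
  rewrite integral_mkcond; apply: eq_integral => x _; rewrite patchE sumEFin.
  case: ifPn => [/set_mem Dx|/negP nDx]; first by rewrite sumG.
  rewrite big1// => i _; apply: G0 => /SD Dx; apply: nDx; exact: mem_set.
have f1 := integrable_fin_num mD i1; have f2 := integrable_fin_num mD i2.
rewrite -[X in (X - _)%E]fineK// -[X in (_ - X)%E]fineK// -EFinB => -[] /eqP.
rewrite subr_eq0 => /eqP h.
by rewrite -[LHS]fineK// -[RHS]fineK// h.
Unshelve. all: by end_near. Qed.

Lemma power_fun_powR (c al p : R) : 0 <= c ->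
  (fun x : 'rV[R]_n => power_fun c al x `^ p) =
  (fun x => c `^ p * sqdist 0 x `^ (al * p / 2)).
Proof.
move=> c0; apply/funext => x; rewrite /power_fun powRM ?powR_ge0// -powRrM.
by rewrite enorm_powR.
Qed.

Lemma power_funE (c al : R) :
  (power_fun c al : 'rV[R]_n -> R) = (fun x => c * sqdist 0 x `^ (al / 2)).
Proof. by apply/funext => x; rewrite /power_fun enorm_powR. Qed.

Lemma positive_pair_power (p q al be : R) :
  positive_pair p q (power_fun 1 al : 'rV[R]_n -> R) (power_fun 1 be).
Proof.
split.
- apply: aeW => x Dx; rewrite !power_funE !mul1r.
  by split; rewrite powR_gt0// sqdist0_gt0.
- by rewrite power_funE; exact: loc_integrable_sqdist_powR.
- by rewrite power_funE; exact: loc_integrable_sqdist_powR.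
- by rewrite power_fun_powR//; exact: loc_integrable_sqdist_powR.
- by rewrite power_fun_powR//; exact: loc_integrable_sqdist_powR.
Qed.

Lemma neg_laplacian_eq_power (al be a p : R) : al - 2 = a + be * p ->
  neg_laplacian_eq D (power_fun 1 al)
    (fun x => - al * (al + (n%:R - 2)) * enorm x `^ a * power_fun 1 be x `^ p).
Proof.
move=> E phi tf.
transitivity (\int[lam]_(x in D) (sqdist 0 x `^ (al / 2) * - laplacian phi x)%:E)%E.
  by apply: eq_integral => x _; rewrite power_funE mul1r.
rewrite power_neg_laplacian//; apply: eq_integral => x /set_mem Dx.
have s0 := sqdist0_gt0 Dx.
congr (_%:E); congr (_ * _).
rewrite /power_fun mul1r -powRrM !enorm_powR -[RHS]mulrA -powRD; last first.
  by rewrite (gt_eqF s0) implybT.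
congr (_ * _ `^ _); first by field.
by rewrite -mulrDl -E; field.
Qed.

End power_functions.

(** * Removing the exceptional null set *)

Section absolute_values.
Context {R : realType} {n : nat}.
Local Notation lam := (lebesgue_rV R n).
Local Notation D := (@punctured R n).
Implicit Types u f g : 'rV[R]_n -> R.

Lemma loc_integrable_ae f g : loc_integrable D f -> measurable_fun D g ->
  {ae lam, forall x, D x -> f x = g x} -> loc_integrable D g.
Proof.
move=> [mf If] mg fg; split=> // K KD cK; have mK := compact_measurable_rV cK.
have mgK : measurable_fun K (EFin \o g).
  by apply/measurable_EFinP; exact: measurable_funS measurable_punctured KD mg.
have mfK : measurable_fun K (EFin \o f).
  by apply/measurable_EFinP; exact: measurable_funS measurable_punctured KD mf.
apply/integrableP; split => //; have /integrableP[_] := If K KD cK.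
apply: le_lt_trans; rewrite le_eqVlt; apply/orP; left; apply/eqP.
apply: ae_eq_integral => //; [exact: measurableT_comp|exact: measurableT_comp|].
by apply: filterS fg => x h Kx /=; rewrite h//; exact: KD.
Qed.

Lemma neg_laplacian_ge_ae u u' f f' : neg_laplacian_ge D u f ->
  measurable_fun D u -> measurable_fun D u' -> measurable_fun D f -> measurable_fun D f' ->
  {ae lam, forall x, D x -> u x = u' x} -> {ae lam, forall x, D x -> f x = f' x} ->
  neg_laplacian_ge D u' f'.
Proof.
move=> ge mu mu' mf mf' uu' ff' phi tf phi0; have mD := @measurable_punctured R n.
have [S [_ _ cl cp _]] := test_function_laplacian tf.
have mc (g : 'rV[R]_n -> R) : continuous g -> measurable_fun D g.
  move=> cg; apply: measurable_funTS; apply: continuous_measurable_rV; first exact: openT.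
  by move=> x _; exact: cg.
have mp := mc _ cp.
have ml : measurable_fun D (fun x => - laplacian phi x).
  by apply: mc => x; apply: continuousN; exact: cl.
have <- : (\int[lam]_(x in D) (f x * phi x)%:E = \int[lam]_(x in D) (f' x * phi x)%:E)%E.
  apply: ae_eq_integral => //; try by apply/measurable_EFinP; exact: measurable_funM.
  by apply: filterS ff' => x h Dx; rewrite h.
have <- : (\int[lam]_(x in D) (u x * - laplacian phi x)%:E =
    \int[lam]_(x in D) (u' x * - laplacian phi x)%:E)%E.
  apply: ae_eq_integral => //; try by apply/measurable_EFinP; exact: measurable_funM.
  by apply: filterS uu' => x h Dx; rewrite h.
exact: ge.
Qed.

(** Positivity holds almost everywhere only, whereas the estimates need a sign at each point.
    Absolute values change the functions on a null set, which affects neither side of the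
    inequality. *)
Lemma nonneg_supersolution_norm (l a p : R) u v : 0 <= l ->
  loc_integrable D u -> measurable_fun D v ->
  measurable_fun D (fun x => v x `^ p) ->
  {ae lam, forall x, D x -> 0 < u x /\ 0 < v x} ->
  neg_laplacian_ge D u (fun x => l * enorm x `^ a * v x `^ p) ->
  nonneg_supersolution (fun x => `|u x|) (fun x => l * enorm x `^ a * `|v x| `^ p).
Proof.
move=> l0 iu mv mvp pos ge; have [mu _] := iu.
have uE : {ae lam, forall x, D x -> u x = `|u x|}.
  by apply: filterS pos => x h /h[u0 _]; rewrite gtr0_norm.
have me : measurable_fun D (fun x : 'rV[R]_n => l * enorm x `^ a).
  have [h _] := @loc_integrable_sqdist_powR R n l (a / 2).
  by move: h; congr measurable_fun; apply/funext => x; rewrite enorm_powR.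
have mw : measurable_fun D (fun x => l * enorm x `^ a * `|v x| `^ p).
  apply: measurable_funM => //.
  apply: (measurableT_comp (measurable_powR p)).
  exact: measurableT_comp.
have mnu : measurable_fun D (fun x => `|u x|) by exact: measurableT_comp.
split => //.
- exact: loc_integrable_ae iu mnu uE.
- by move=> x; rewrite !mulr_ge0 ?powR_ge0.
- apply: (neg_laplacian_ge_ae ge) => //; first exact: measurable_funM.
  by apply: filterS pos => x h /h[_ v0]; rewrite (gtr0_norm v0).
Qed.

End absolute_values.

(** * The equivalence *)

Section main.
Context {R : realType}.

Lemma log_harnackW (N C C' : R) u : C <= C' -> log_harnack N C u -> log_harnack N C' u.
Proof. by move=> CC' H j k; have := H j k; lra. Qed.

Lemma log_greenW (N A p C C' : R) u v : C <= C' -> log_green N A p C u v -> log_green N A p C' u v.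
Proof.
move=> CC' H j s us; apply: le_trans (H j s us).
by apply: ler_sum => k _; rewrite ler_expR; lra.
Qed.

Lemma supersolution_exponents n (p q a b l1 l2 : R) (u v : 'rV[R]_n -> R) :
  (3 <= n)%N -> 0 < p -> 0 < q -> 0 < l1 -> 0 < l2 ->
  loc_integrable punctured u -> loc_integrable punctured v ->
  {ae lebesgue_rV R n, forall x, punctured x -> 0 < u x} ->
  {ae lebesgue_rV R n, forall x, punctured x -> 0 < v x} ->
  nonneg_supersolution u (fun x => l1 * enorm x `^ a * v x `^ p) ->
  nonneg_supersolution v (fun x => l2 * enorm x `^ b * u x `^ q) ->
  exists al be, [/\ - (n%:R - 2) < al < 0, - (n%:R - 2) < be < 0,
    al - 2 = a + be * p & be - 2 = b + al * q].
Proof.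
move=> n3 p0 q0 l10 l20 iu iv pu pv su sv.
have N2 : (n - 2)%N%:R = n%:R - 2 :> R by rewrite natrB// ltnW.
have N0 : 0 < (n - 2)%N%:R :> R by rewrite ltr0n subn_gt0.
have posu k := average_gt0 n3 (expR_gt0 (k%:~R : R)) iu pu.
have posv k := average_gt0 n3 (expR_gt0 (k%:~R : R)) iv pv.
have [C1 H1] := @log_harnack_average R n n3.
have [C2 H2] := @log_green_average R n n3 l1 a p l10.
have [C3 H3] := @log_green_average R n n3 l2 b q l20.
pose C := Num.max C1 (Num.max C2 C3).
have h1 : C1 <= C by rewrite le_max lexx.
have h2 : C2 <= C by rewrite !le_max lexx orbT.
have h3 : C3 <= C by rewrite !le_max lexx !orbT.
have [al [be [hal hbe e1 e2]]] := log_exponents N0 p0 q0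
  (log_harnackW h1 (H1 _ _ su posu)) (log_harnackW h1 (H1 _ _ sv posv))
  (log_greenW h2 (H2 _ _ _ su sv p0 posu posv)) (log_greenW h3 (H3 _ _ _ sv su q0 posv posu)).
by exists al, be; rewrite -N2; split => //; lra.
Qed.

End main.

Theorem theorem1p4 (R : realType) (n : nat) (p q a b : R) :
  (3 <= n)%N -> 1 < p -> 1 < q ->
  (exists (u v : 'rV[R]_n -> R) (l1 l2 : R),
     [/\ 0 < l1, 0 < l2 & system_supersolution p q a b l1 l2 u v])
  <->
  (exists l1 l2 c1 c2 alpha beta : R,
     [/\ 0 < l1 /\ 0 < l2, 0 < c1 /\ 0 < c2 &
       system_solution p q a b l1 l2
         (power_fun c1 alpha : 'rV[R]_n -> R) (power_fun c2 beta)]).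
Proof.
move=> n3 p1 q1; split; last first.
  (* Equality against all test functions contains the inequality against the nonnegative ones. *)
  move=> [l1 [l2 [c1 [c2 [al [be [[l10 l20] _ [pp e1 e2]]]]]]]].
  exists (power_fun c1 al), (power_fun c2 be), l1, l2; split => //; split => //.
  - by move=> phi tf _; rewrite e1.
  - by move=> phi tf _; rewrite e2.
move=> [u [v [l1 [l2 [l10 l20 [[pos iu iv [muq _] [mvp _]] ge1 ge2]]]]]].
have [mu _] := iu; have [mv _] := iv.
have pos' : {ae lebesgue_rV R n, forall x, punctured x -> 0 < v x /\ 0 < u x}.
  by apply: filterS pos => x h /h[].
have su := nonneg_supersolution_norm (ltW l10) iu mv mvp pos ge1.
have sv := nonneg_supersolution_norm (ltW l20) iv mu muq pos' ge2.
have [iu' _ _ _ _] := su; have [iv' _ _ _ _] := sv.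
have pu : {ae lebesgue_rV R n, forall x, punctured x -> 0 < `|u x|}.
  by apply: filterS pos => x h /h[u0 _]; rewrite normr_gt0 gt_eqF.
have pv : {ae lebesgue_rV R n, forall x, punctured x -> 0 < `|v x|}.
  by apply: filterS pos => x h /h[_ v0]; rewrite normr_gt0 gt_eqF.
have p0 : 0 < p - 1 by rewrite subr_gt0.
have q0 : 0 < q - 1 by rewrite subr_gt0.
have [al [be [/andP[al1 al2] /andP[be1 be2] e1 e2]]] :=
  supersolution_exponents n3 p0 q0 l10 l20 iu' iv' pu pv su sv.
(* With c1 = c2 = 1 the constants are the coefficients in -Delta |x|^al = - al (al + n - 2)
   |x|^(al-2) and its analogue for be; they are positive precisely because both exponents lie in
   ]2-n, 0[. *)
exists (- al * (al + (n%:R - 2))), (- be * (be + (n%:R - 2))), 1, 1, al, be.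
split; first by split; apply: mulr_gt0; lra.
  by [].
split; first exact: positive_pair_power.
- exact: neg_laplacian_eq_power.
- exact: neg_laplacian_eq_power.
Qed.
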